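(* Let $n$ be a positive integer, $G_n$ a non-trivial finite group, $\mathcal{G}_n=G_n\wr S_n$, and let $\widehat{G}_n=\{\sigma_1,\dots,\sigma_t\}$ be the set of (isomorphism classes of) irreducible complex representations of $G_n$, with $\sigma_1=\mathbb{1}$ the trivial representation. Let $\mu=(\mu^{(1)},\dots,\mu^{(t)})$ be a Young $G_n$-diagram with $n$ boxes, and let $m_i=|\mu^{(i)}|$, $d_i=\dim(W^{\sigma_i})$. Let $\widehat{P}(R)|_{V^\mu}$ be the restriction of $\widehat P(R)$ to the irreducible $\mathcal{G}_n$-module $V^\mu$. Then the eigenvalues of $\widehat{P}(R)|_{V^\mu}$ are given by $$\frac{1}{n\dim(W^{r_T(n)})}\Big(c(b_T(n))+\langle\chi^{r_T(n)},\chi^{\mathbb{1}}\rangle\Big),\quad\text{with multiplicity } d_1^{m_1}\cdots d_t^{m_t},$$ for each standard Young $G_n$-tableau $T$ of shape $\mu$.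
   Context: For a finite group $G$, the wreath product $G\wr S_n$ consists of tuples $(g_1,\dots,g_n;\pi)$ with $g_i\in G$, $\pi\in S_n$, with multiplication $(g_1,\dots,g_n;\pi)(h_1,\dots,h_n;\eta)=(g_1h_{\pi^{-1}(1)},\dots,g_nh_{\pi^{-1}(n)};\pi\eta)$. Write $\mathrm{e}$ for the identity of $G_n$ and $\mathrm{id}$ for the identity of $S_n$. The probability measure $P$ on $\mathcal{G}_n$ gives mass $\frac{1}{n|G_n|}$ to each element $(\mathrm{e},\dots,\mathrm{e},g;\mathrm{id})$, $g\in G_n$, and mass $\frac{1}{n|G_n|}$ to each element $(\mathrm{e},\dots,\mathrm{e},g^{-1},\mathrm{e},\dots,\mathrm{e},g;(i,n))$ ($g^{-1}$ in position $i$, $g$ in position $n$), $g\in G_n$, $1\le i<n$; all other elements have mass $0$. $R$ is the right regular representation of $\mathcal{G}_n$ on $\mathbb{C}[\mathcal{G}_n]$, $R(x)h=hx^{-1}$, and $\widehat P(R)=\sum_{x}P(x)R(x)$ (this is the transition matrix of the random walk on $\mathcal{G}_n$ driven by $P$). Its restriction to $V^\mu$ means its restriction to an irreducible submodule of $\mathbb{C}[\mathcal{G}_n]$ isomorphic to $V^\mu$, i.e. the operator $\sum_x P(x)\rho_\mu(x)$ where $\rho_\mu$ is the representation on $V^\mu$. $W^{\sigma}$ is the irreducible $G_n$-module of $\sigma\in\widehat G_n$, with character $\chi^\sigma$; $\langle\phi,\psi\rangle=\frac1{|G_n|}\sum_{g\in G_n}\phi(g)\psi(g^{-1})$ (so $\langle\chi^\sigma,\chi^{\mathbb{1}}\rangle$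 is $1$ if $\sigma=\mathbb 1$ and $0$ otherwise). A Young $G_n$-diagram with $n$ boxes is a map $\mu$ from $\widehat G_n$ to the set of Young diagrams (the empty diagram allowed) with $n$ boxes in total; write $\mu^{(i)}=\mu(\sigma_i)$. These index the irreducible $\mathcal{G}_n$-modules in the standard way: $V^\mu$ is induced from $\prod_i G_n\wr S_{m_i}$ of the outer tensor product over $i$ of the modules $(W^{\sigma_i})^{\otimes m_i}\otimes S^{\mu^{(i)}}$, where $S^{\lambda}$ is the Specht module of $\lambda$ (the one-row diagram giving the trivial representation), $G_n^{m_i}$ acts factorwise on $(W^{\sigma_i})^{\otimes m_i}$, and $S_{m_i}$ acts by permuting the tensor factors and by its action on $S^{\mu^{(i)}}$. A standard Young $G_n$-tableau $T$ of shape $\mu$ is a bijective filling of the $n$ boxes of $\mu$ with $1,\dots,n$ such that numbers strictly increase along rows and columns of every $\mu^{(i)}$. If the number $n$ lies in the diagram $\mu(\sigma)$, then $r_T(n)=\sigma$; $b_T(n)$ is the box containing $n$; and the content $c(b)$ of a box $b$ in row $p$ and column $q$ is $q-p$. *)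

(* Defs.v *)
From HB Require Import structures.
From mathcomp Require Import all_boot all_order all_algebra.
From mathcomp Require Import all_fingroup all_solvable all_field all_character.

Set Implicit Arguments.
Unset Strict Implicit.
Unset Printing Implicit Defensive.

Import GRing.Theory Num.Theory GroupScope.
Local Open Scope ring_scope.

(* Convention: a left module V with basis (v_b) is represented by the matrices
   rho(x) with x v_b = \sum_a rho(x)_(a, b) v_a, i.e. matrices acting on
   columns; then rho(x y) = rho(x) *m rho(y), as mx_representation requires. *)

Section Wreath.
Variables (gT : finGroupType) (n : nat).

Definition wreath := ({ffun 'I_n -> gT} * 'S_n)%type.

HB.instance Definition _ := Finite.on wreath.

(* In the wreath product pi eta stands for pi \o eta, which is (eta * pi)%g in
   perm.v, where products are read from left to right. *)
Definition wreath_mul (x y : wreath) : wreath :=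
  ([ffun i => x.1 i * y.1 (x.2^-1 i)]%g, (y.2 * x.2)%g).
Definition wreath_one : wreath := ([ffun=> 1%g], 1%g).
Definition wreath_inv (x : wreath) : wreath :=
  ([ffun i => (x.1 (x.2 i))^-1%g], x.2^-1%g).

Lemma wreath_mulA : associative wreath_mul.
Proof.
move=> x y z; congr (_, _); last by rewrite /= mulgA.
by apply/ffunP=> i; rewrite !ffunE /= invMg permM mulgA.
Qed.

Lemma wreath_mul1 : left_id wreath_one wreath_mul.
Proof.
move=> [g s]; congr (_, _); last by rewrite /= mulg1.
by apply/ffunP=> i; rewrite !ffunE /= invg1 perm1 mul1g.
Qed.

Lemma wreath_mulV : left_inverse wreath_one wreath_inv wreath_mul.
Proof.
move=> [g s]; congr (_, _); last by rewrite /= mulgV.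
by apply/ffunP=> i; rewrite !ffunE /= invgK mulVg.
Qed.

HB.instance Definition _ :=
  Finite_isGroup.Build wreath wreath_mulA wreath_mul1 wreath_mulV.

Lemma wreath_mulE (x y : wreath) : (x * y)%g = wreath_mul x y.
Proof. by []. Qed.

Lemma wreath_oneE : (1 : wreath)%g = wreath_one.
Proof. by []. Qed.

End Wreath.

Section IndexedMatrix.
Variables (C : comUnitRingType) (I : finType).

Definition ixmx (E : I -> I -> C) : 'M[C]_#|I| :=
  \matrix_(a, b) E (enum_val a) (enum_val b).

Lemma ixmx1 : ixmx (fun a b => (a == b)%:R) = 1%:M.
Proof. by apply/matrixP=> a b; rewrite !mxE (inj_eq enum_val_inj). Qed.

Lemma ixmxM E F : ixmx E *m ixmx F = ixmx (fun a b => \sum_c E a c * F c b).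
Proof.
apply/matrixP=> a b; rewrite !mxE (reindex (@enum_val I predT)) /=.
  by apply: eq_bigr => c _; rewrite !mxE.
by exists enum_rank => c _; rewrite (enum_valK, enum_rankK).
Qed.

Lemma eq_ixmx E F : E =2 F -> ixmx E = ixmx F.
Proof. by move=> EF; apply/matrixP=> a b; rewrite !mxE EF. Qed.

End IndexedMatrix.

(* A Young diagram is given by its row lengths; rows and columns are numbered
   from 0, which does not affect contents. *)
Definition is_partition (lam : seq nat) := sorted geq lam && (0%N \notin lam).
Definition in_diagram (lam : seq nat) (p q : nat) := (q < nth 0%N lam p)%N.

Section Specht.
Variables (C : fieldType) (lam : seq nat).
Local Notation m := (sumn lam).

(* A tableau maps each number k to the (row, column) of the box containing k. *)
Definition is_tableau (t : {ffun 'I_m -> 'I_m * 'I_m}) :=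
  injectiveb t && (t @: setT == [set b : 'I_m * 'I_m | in_diagram lam b.1 b.2]).

(* The tabloid {t} is the map sending each number to its row in t; the
   permutation s sends {t} to {s t}, where s t has s k in the box of k. *)
Definition rowfun := {ffun 'I_m -> 'I_m}.
Definition tabloid (t : {ffun 'I_m -> 'I_m * 'I_m}) : rowfun :=
  [ffun k => (t k).1].
Definition tabloid_act (s : 'S_m) (f : rowfun) : rowfun :=
  [ffun k => f (s^-1%g k)].

Definition col_stab (t : {ffun 'I_m -> 'I_m * 'I_m}) : {set 'S_m} :=
  [set s : 'S_m | [forall k, (t (s k)).2 == (t k).2]].

Definition tabvec (f : rowfun) : 'rV[C]_#|rowfun| :=
  delta_mx 0 (enum_rank f).

Definition polytabloid t : 'rV[C]_#|rowfun| :=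
  \sum_(s in col_stab t) (-1) ^+ s *: tabvec (tabloid_act s (tabloid t)).

(* 'S_m acts on rows: v *m tabloid_mx s is s v. As products in perm.v are read
   from left to right, this is a representation. *)
Definition tabloid_mx (s : 'S_m) : 'M[C]_#|rowfun| :=
  \matrix_a tabvec (tabloid_act s (enum_val a)).

Lemma tabvecJ s f : tabvec f *m tabloid_mx s = tabvec (tabloid_act s f).
Proof. by rewrite -rowE rowK enum_rankK. Qed.

Lemma tabloid_act1 f : tabloid_act 1%g f = f.
Proof. by apply/ffunP=> k; rewrite !ffunE invg1 perm1. Qed.

Lemma tabloid_actM s t f :
  tabloid_act (s * t)%g f = tabloid_act t (tabloid_act s f).
Proof. by apply/ffunP=> k; rewrite !ffunE invMg permM. Qed.

Lemma tabloid_mx_repr : mx_repr [set: 'S_m] tabloid_mx.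
Proof.
split=> [|s t _ _]; apply/row_matrixP=> a; rewrite rowK.
  by rewrite tabloid_act1 row1 /tabvec enum_valK.
by rewrite row_mul rowK tabvecJ tabloid_actM.
Qed.
Canonical tabloid_repr := MxRepresentation tabloid_mx_repr.

Definition tableau_act (s : 'S_m) (t : {ffun 'I_m -> 'I_m * 'I_m}) :
  {ffun 'I_m -> 'I_m * 'I_m} := [ffun k => t (s^-1%g k)].

Lemma is_tableau_act s t : is_tableau t -> is_tableau (tableau_act s t).
Proof.
case/andP=> /injectiveP tI /eqP tE; apply/andP; split.
  by apply/injectiveP=> i j; rewrite !ffunE => /tI/perm_inj.
rewrite -tE eqEsubset; apply/andP; split; apply/subsetP=> b /imsetP[k _ ->].
  by rewrite ffunE imset_f ?inE.
by apply/imsetP; exists (s k); rewrite ?inE // ffunE permK.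
Qed.

Lemma polytabloidJ s t :
  polytabloid t *m tabloid_mx s = polytabloid (tableau_act s t).
Proof.
rewrite mulmx_suml /polytabloid [RHS](reindex_inj (conjg_inj s)) /=.
apply: eq_big => [u | u _].
  rewrite !inE; apply/forallP/forallP => tu k; last first.
    by have := tu (s k); rewrite !ffunE permJ !permK.
  by rewrite !ffunE -[k](permKV s) permJ !permK.
rewrite -scalemxAl tabvecJ; congr (_ *: tabvec _).
  by rewrite odd_permJ.
by apply/ffunP=> k; rewrite !ffunE /conjg !invMg !permM invgK permK.
Qed.

Definition specht_mx : 'M[C]_#|rowfun| :=
  (\sum_(t | is_tableau t) <<polytabloid t>>)%MS.

Lemma specht_module : mxmodule tabloid_repr specht_mx.
Proof.
apply/mxmoduleP=> s _; rewrite sumsmxMr; apply/sumsmx_subP=> t tP.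
rewrite (eqmxMr _ (genmxE _)) polytabloidJ.
by apply: (sumsmx_sup (tableau_act s t)); rewrite ?is_tableau_act ?genmxE.
Qed.

Definition specht_repr := submod_repr specht_module.

End Specht.

Section Block.
Variables (C : fieldType) (gT : finGroupType) (d : nat).
Variables (W : mx_representation C [set: gT] d) (lam : seq nat).
Local Notation m := (sumn lam).
Local Notation sdim := (\rank (specht_mx C lam)).

(* Index set of the basis of W^{\otimes m} \otimes S^lam. *)
Definition block_index := ({ffun 'I_m -> 'I_d} * 'I_sdim)%type.

(* (g; pi) maps w_1 \otimes ... \otimes w_m \otimes v to
   g_1 w_(pi^-1 1) \otimes ... \otimes g_m w_(pi^-1 m) \otimes pi v.
   The Specht factor is transposed because specht_repr acts on rows. *)
Definition block_entry (x : wreath gT m) (a b : block_index) : C :=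
  (\prod_j W (x.1 j) (a.1 j) (b.1 (x.2^-1%g j)))
  * (specht_repr C lam x.2)^T a.2 b.2.

Definition block_mx (x : wreath gT m) := ixmx (block_entry x).

Lemma block_mx_repr : mx_repr [set: wreath gT m] block_mx.
Proof.
split=> [|x y _ _]; rewrite /block_mx.
  rewrite -ixmx1; apply: eq_ixmx => -[a s] [b t]; rewrite /block_entry /=.
  rewrite (@repr_mx1 _ _ _ _ (specht_repr C lam)) !mxE [t == s]eq_sym.
  rewrite -pair_eqE /= -mulnb natrM; congr (_ * _).
  have E j : W ([ffun=> 1%g] j : gT) (a j) (b ((1^-1 : 'S_m)%g j))
      = (a j == b j)%:R by rewrite ffunE repr_mx1 mxE invg1 perm1.
  rewrite (eq_bigr _ (fun j _ => E j)); have [->|ne] := eqVneq a b.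
    by rewrite big1 // => j _; rewrite eqxx.
  have [j nej] : exists j, a j != b j.
    by apply/existsP; apply: contra_neqT ne => /existsPn ab;
       apply/ffunP=> j; apply/eqP; have := ab j; rewrite negbK.
  by rewrite (bigD1 j) //= (negPf nej) mul0r.
rewrite ixmxM; apply: eq_ixmx => -[a s] [b t].
rewrite -(pair_bigA _ (fun c u => block_entry x (a, s) (c, u)
  * block_entry y (c, u) (b, t))) /block_entry /=.
rewrite (@repr_mxM _ _ _ _ (specht_repr C lam)) ?inE // trmx_mul !mxE.
rewrite (eq_bigr (fun c : {ffun 'I_m -> 'I_d} =>
   (\prod_j W (x.1 j) (a j) (c (x.2^-1%g j)))
   * (\prod_j W (y.1 j) (c j) (b (y.2^-1%g j)))
   * \sum_u (specht_repr C lam x.2)^T s u * (specht_repr C lam y.2)^T u t));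
  last by move=> c _; rewrite big_distrr /=; apply: eq_bigr => u _; rewrite mulrACA.
rewrite -big_distrl /=; congr (_ * _).
rewrite (eq_bigr (fun j => \sum_c W (x.1 j) (a j) c
    * W (y.1 (x.2^-1%g j)) c (b (y.2^-1%g (x.2^-1%g j))))); last first.
  by move=> j _; rewrite ffunE repr_mxM ?inE // mxE invMg permM.
rewrite bigA_distr_bigA /=.
rewrite (reindex (fun c : {ffun 'I_m -> 'I_d} => [ffun j => c (x.2^-1%g j)])) /=.
  apply: eq_bigr => c _; rewrite [X in _ * X](reindex_inj (@perm_inj _ x.2^-1%g)) /=.
  by rewrite -big_split /=; apply: eq_bigr => j _; rewrite ffunE.
exists (fun c : {ffun 'I_m -> 'I_d} => [ffun j => c (x.2 j)]) => c _;
  by apply/ffunP=> j; rewrite !ffunE (permK, permKV).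
Qed.
Canonical block_repr := MxRepresentation block_mx_repr.

End Block.

Section OuterTensor.
Variables (C : fieldType) (I : finType) (gT : I -> finGroupType) (d : I -> nat).
Variable r : forall i, mx_representation C [set: gT i] (d i).

Definition outer_entry (y : {dffun forall i, gT i})
  (a b : {dffun forall i, 'I_(d i)}) : C := \prod_i r i (y i) (a i) (b i).

Definition outer_mx y := ixmx (outer_entry y).

Lemma bigA_distr_dffun (J : I -> finType) (F : forall i, J i -> C) :
  \prod_i \sum_(j : J i) F i j
    = \sum_(f : {dffun forall i, J i}) \prod_i F i (f i).
Proof.
pose F' i : {ffun J i -> C} := [ffun u => F i u].
rewrite (reindex (@dffun_of_fprod I J)); last exact/onW_bij/dffun_of_fprod_bij.
transitivity (\sum_(t : fprod J) \prod_i F' i (t i)); last first.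
  by apply: eq_bigr => t _; apply: eq_bigr => i _; rewrite !ffunE.
rewrite (@big_fprod_dep _ _ _ _ _ _ _ F' predT) /=.
rewrite (eq_bigl (mem (family (tagged_with J)))) => [|g]; last exact: andbT.
rewrite -(bigA_distr_big_dep _ (fun i u => untag 0 (F' i) u)).
apply: eq_bigr => i _; rewrite (eq_bigr (F' i)); last first.
  by move=> u _; rewrite ffunE.
by rewrite (big_tag (fun i => F' i)); apply: eq_bigl.
Qed.

Lemma outer_mx_repr : mx_repr [set: {dffun forall i, gT i}] outer_mx.
Proof.
split=> [|x y _ _]; rewrite /outer_mx.
  rewrite -ixmx1; apply: eq_ixmx => a b; rewrite /outer_entry.
  have E i : r i ((1 : {dffun forall i, gT i})%g i) (a i) (b i)
      = (a i == b i)%:R by rewrite ffunE repr_mx1 mxE.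
  rewrite (eq_bigr _ (fun i _ => E i)); have [->|ne] := eqVneq a b.
    by rewrite big1 // => j _; rewrite eqxx.
  have [j nej] : exists j, a j != b j.
    by apply/existsP; apply: contra_neqT ne => /existsPn ab;
       apply/ffunP=> j; apply/eqP; have := ab j; rewrite negbK.
  by rewrite (bigD1 j) //= (negPf nej) mul0r.
rewrite ixmxM; apply: eq_ixmx => a b; rewrite /outer_entry.
rewrite (eq_bigr (fun i => \sum_c r i (x i) (a i) c * r i (y i) c (b i)));
  last by move=> i _; rewrite ffunE repr_mxM ?inE // mxE.
by rewrite bigA_distr_dffun; apply: eq_bigr => c _; rewrite big_split.
Qed.
Canonical outer_repr := MxRepresentation outer_mx_repr.

End OuterTensor.

Section Induced.
Variables (C : fieldType) (aT : finGroupType) (H : {group aT}) (d : nat).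
Variable r : mx_representation C H d.

(* Matrix form of induction: with one representative t_A in each left coset A
   of H, the block of x at (A, B) is r(t_A^-1 x t_B) if t_A^-1 x t_B lies in H,
   and 0 otherwise. *)
Local Notation lcoset_type := {A : {set aT} | A \in lcosets H [set: aT]}.
Definition ind_index := (lcoset_type * 'I_d)%type.

Definition ind_entry (x : aT) (a b : ind_index) : C :=
  let h := ((repr (val a.1))^-1 * x * repr (val b.1))%g in
  if h \in H then r h a.2 b.2 else 0.

Definition ind_mx (x : aT) := ixmx (ind_entry x).

Lemma repr_lcoset (A : lcoset_type) :
  val A = (repr (val A) *: H)%g.
Proof.
case: A => A /= /lcosetsP[x _ ->].
by apply/esym/lcoset_eqP/(mem_repr x)/lcoset_refl.
Qed.

Lemma repr_lcosetV (A B : lcoset_type) (x : aT) :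
  ((repr (val A))^-1 * x * repr (val B) \in H)%g
  = (val B == (x^-1 * repr (val A)) *: H)%g.
Proof.
rewrite {2}[val B]repr_lcoset; apply/idP/eqP => [h|/lcoset_eqP].
  by apply/lcoset_eqP; rewrite mem_lcoset invMg invgK.
by rewrite mem_lcoset invMg invgK.
Qed.

Lemma ind_mx_repr : mx_repr [set: aT] ind_mx.
Proof.
split=> [|x y _ _]; rewrite /ind_mx.
  rewrite -ixmx1; apply: eq_ixmx => -[A a] [B b]; rewrite /ind_entry /=.
  rewrite repr_lcosetV invg1 mul1g -repr_lcoset eq_sym val_eqE -pair_eqE /=.
  have [<-|//] := eqVneq A B.
  by rewrite mulg1 mulVg repr_mx1 mxE.
rewrite ixmxM; apply: eq_ixmx => -[A a] [D b].
have xAP : ((x^-1 * repr (val A)) *: H)%g \in lcosets H [set: aT].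
  by apply/lcosetsP; exists (x^-1 * repr (val A))%g; rewrite ?inE.
pose B : lcoset_type :=
  exist (fun A => A \in lcosets H [set: aT]) _ xAP.
rewrite -(pair_bigA _ (fun E c => ind_entry x (A, a) (E, c)
  * ind_entry y (E, c) (D, b))) /= (bigD1 B) //= [X in _ + X]big1 ?addr0.
  rewrite /ind_entry /=.
  have hx : ((repr (val A))^-1 * x * repr (val B) \in H)%g.
    by rewrite repr_lcosetV.
  rewrite hx; set h := (_ * repr (val B))%g.
  set k := ((repr (val B))^-1 * y * _)%g.
  have -> : ((repr (val A))^-1 * (x * y) * repr (val D) = h * k)%g.
    by rewrite /h /k !mulgA mulgK.
  rewrite groupMl //; case: ifP => [hk|_]; last first.
    by rewrite big1 // => c _; rewrite mulr0.
  by rewrite repr_mxM // mxE.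
move=> E neE; apply: big1 => c _; rewrite /ind_entry /=.
by rewrite repr_lcosetV -[((x^-1 * _) *: H)%g]/(val B) val_eqE (negPf neE) mul0r.
Qed.
Canonical ind_repr := MxRepresentation ind_mx_repr.

End Induced.

Section YoungSubgroup.
Variables (gT : finGroupType) (I : finType) (m : I -> nat) (n : nat).
Hypothesis mn : (\sum_i m i)%N = n.

(* The n positions are cut into consecutive blocks of sizes m i: slot_of sends
   a position to its block and its rank in the block. *)
Local Notation slot := {i : I & 'I_(m i)}.

Lemma card_slot : #|{: slot}| = n.
Proof.
rewrite card_tagged sumnE big_map big_enum -mn /=.
by apply: eq_bigr => i _; rewrite card_ord.
Qed.

Definition pos_of (w : slot) : 'I_n := cast_ord card_slot (enum_rank w).
Definition slot_of (j : 'I_n) : slot := enum_val (cast_ord (esym card_slot) j).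

Lemma pos_ofK : cancel pos_of slot_of.
Proof. by move=> w; rewrite /slot_of cast_ordK enum_rankK. Qed.

Lemma slot_ofK : cancel slot_of pos_of.
Proof. by move=> j; rewrite /pos_of enum_valK cast_ordKV. Qed.

Definition slot_perm (s : forall i, 'S_(m i)) (w : slot) : slot :=
  Tagged (fun i => 'I_(m i)) (s (tag w) (tagged w)).

Definition young_fun (s : forall i, 'S_(m i)) (j : 'I_n) : 'I_n :=
  pos_of (slot_perm s (slot_of j)).

Lemma young_funK s :
  cancel (young_fun s) (young_fun (fun i => (s i)^-1%g)).
Proof.
move=> j; rewrite /young_fun pos_ofK -[RHS]slot_ofK; congr pos_of.
by case: (slot_of j) => i k; rewrite /slot_perm /= permK.
Qed.

Definition young_emb (y : {dffun forall i, wreath gT (m i)}) : wreath gT n :=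
  ([ffun j => (y (tag (slot_of j))).1 (tagged (slot_of j))],
   perm (can_inj (young_funK (fun i => (y i).2)))).

Lemma young_embV y j :
  ((young_emb y).2^-1)%g j = young_fun (fun i => ((y i).2)^-1%g) j.
Proof.
apply: (@perm_inj _ (young_emb y).2); rewrite permKV permE /young_fun pos_ofK.
rewrite -[LHS]slot_ofK; congr pos_of.
by case: (slot_of j) => i k; rewrite /slot_perm /= permKV.
Qed.

Lemma young_embM : {morph young_emb : x y / (x * y)%g}.
Proof.
move=> x y; rewrite wreath_mulE /wreath_mul; congr (_, _).
  by apply/ffunP=> j; rewrite !ffunE young_embV /young_fun pos_ofK.
apply/permP=> j; rewrite permM !permE /young_fun pos_ofK; congr pos_of.
by rewrite /slot_perm /= ffunE permM.
Qed.
Canonical young_morphism := @Morphism _ _ [set: _] young_emb (in2W young_embM).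

Lemma young_injm : 'injm young_emb.
Proof.
apply/injmP=> x y _ _ [/ffunP gE /permP sE].
apply/ffunP=> i; have E k := congr1 slot_of (sE (pos_of (Tagged _ k))).
rewrite (surjective_pairing (x i)) (surjective_pairing (y i)); congr (_, _).
  apply/ffunP=> k; have := gE (pos_of (Tagged (fun i => 'I_(m i)) k)).
  by rewrite !ffunE pos_ofK.
apply/permP=> k; have := E i k; rewrite !permE /young_fun !pos_ofK.
by rewrite /slot_perm /= => /eqP; rewrite eq_Tagged => /eqP.
Qed.

End YoungSubgroup.

(* For G = [set: gT], sG : irrType C G indexes the irreducible representations
   irr_repr i of G, of dimension irr_degree i, up to isomorphism. *)
Section GDiagram.
Variables (C : closedFieldType) (gT : finGroupType).
Variable sG : irrType C [set: gT].

Record gdiagram (n : nat) := GDiagram {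
  gshape :> sG -> seq nat;
  gshape_partition : forall i, is_partition (gshape i);
  gshape_size : (\sum_i sumn (gshape i))%N = n }.

Variables (n : nat) (mu : gdiagram n).

(* The outer tensor product over i of the modules
   (W^(sigma_i))^{\otimes m_i} \otimes S^(mu i), first as a module over the
   product of the groups G wr S_(m_i), then over the image of this product in
   G wr S_n. *)
Definition blocks_repr :=
  outer_repr (fun i : sG => block_repr (irr_repr i) (mu i)).
Definition young_repr :=
  morphpre_repr (invm_morphism (young_injm gT (gshape_size mu))) blocks_repr.

Definition V_repr := ind_repr young_repr.

(* T k is the box containing k, given by its diagram, row and column. *)
Definition gbox := (sG * ('I_n * 'I_n))%type.

Definition standard_gtableau (T : {ffun 'I_n -> gbox}) :=
  [&& injectiveb T,
      T @: setT == [set b : gbox | in_diagram (mu b.1) b.2.1 b.2.2],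
      [forall k, forall l, [&& (T k).1 == (T l).1, (T k).2.1 == (T l).2.1
         & ((T k).2.2 < (T l).2.2)%N] ==> (k < l)%N]
    & [forall k, forall l, [&& (T k).1 == (T l).1, (T k).2.2 == (T l).2.2
         & ((T k).2.1 < (T l).2.1)%N] ==> (k < l)%N]].

Definition content (b : gbox) : int := b.2.2%:Z - b.2.1%:Z.

End GDiagram.

Section Characters.
Variables (C : fieldType) (gT : finGroupType).

Definition rchar d (r : mx_representation C [set: gT] d) (g : gT) : C :=
  \tr (r g).

Definition chardot (phi psi : gT -> C) : C :=
  #|gT|%:R^-1 * \sum_g phi g * psi g^-1%g.

End Characters.

Section Walk.
Variables (C : numFieldType) (gT : finGroupType) (n : nat).

(* (e, ..., e, g; id) *)
Definition top_elt (g : gT) : wreath gT n.+1 :=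
  ([ffun k => if k == ord_max then g else 1%g], 1%g).

(* (e, ..., e, g^-1, e, ..., e, g; (i, n)) with g^-1 in position i *)
Definition swap_elt (i : 'I_n.+1) (g : gT) : wreath gT n.+1 :=
  ([ffun k => if k == i then g^-1%g else if k == ord_max then g else 1%g],
   tperm i ord_max).

Definition walk_prob (x : wreath gT n.+1) : C :=
  if [exists g, x == top_elt g]
     || [exists i : 'I_n.+1, (i < n)%N && [exists g, x == swap_elt i g]]
  then (n.+1 * #|gT|)%N%:R^-1 else 0.

End Walk.
Arguments walk_prob : clear implicits.

Definition fourier (C : fieldType) (aT : finGroupType) (P : aT -> C)
  d (r : mx_representation C [set: aT] d) : 'M[C]_d := \sum_x P x *: r x.

(* The matrix of h |-> h x^-1 in the group algebra. *)
Lemma regular_reprE (C : fieldType) (aT : finGroupType) (x : aT) k h :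
  regular_repr C [set: aT] x k h
    = ((enum_val k : aT) == (enum_val h * x^-1)%g)%:R.
Proof.
rewrite /= mxE mxE eqxx /= -(inj_eq enum_val_inj) gring_indexK ?inE //.
congr (_%:R); congr nat_of_bool.
by apply/idP/idP => /eqP ->; rewrite ?mulgK ?mulgKV.
Qed.

(* The columns of B form a basis of a subspace stable by A, and M is the matrix
   in this basis of the restriction of A to this subspace. *)
Definition is_restriction (C : fieldType) N d (A : 'M[C]_N) (B : 'M[C]_(N, d))
  (M : 'M[C]_d) := \rank B = d /\ A *m B = B *m M.

(* Main.v *)
(* Write x_N(g) for g in position N, and x_iN(g) for (g^-1 in position i, g in
   position N; (i N)).  On V^mu, which is the direct sum over the cosets of the
   Young subgroup, i.e. over the assignments f of an irreducible sigma to each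
   position, Schur orthogonality makes the average over g of x_N(g) the indicator
   of f(N) = 1, and that of x_iN(g) zero unless f(i) = f(N) = sigma; in that case
   the two flips of the factors i and N of the tensor power of W^sigma cancel, and
   what remains is 1/dim(W^sigma) times the transposition (i N) acting on the
   Specht factor.  The walk thus acts on the f-component as a Jucys-Murphy element
   of one Specht module, tensored with identities.

   The Jucys-Murphy element of the largest label k0 is triangular in the basis of
   standard polytabloids e_t, graded by the column c of k0: the transpositions of
   k0 with a column to the left of c sum to the identity on e_t (Garnir), those
   with the rest of column c contribute -1 each, i.e. minus the row of k0, and the
   others move k0 to the right.  So the diagonal entries are the contents of k0.

   Labels are ordered by an arbitrary injection v into nat; with v the positions
   occupied by a block, standard G-tableaux are exactly the pairs of a coset and a
   family of v-standard tableaux, without renumbering. *)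

Require Import Defs.
From mathcomp Require Import all_boot all_order all_algebra.
From mathcomp Require Import all_fingroup all_solvable all_field all_character.
From mathcomp Require Import zify ring.

Set Implicit Arguments.
Unset Strict Implicit.
Unset Printing Implicit Defensive.

Import GRing.Theory Num.Theory.
Local Open Scope ring_scope.

Lemma nth_leq_sumn (l : seq nat) i : (nth 0 l i <= sumn l)%N.
Proof.
elim: l i => [|a l IH] [|i] //=; first exact: leq_addr.
exact: leq_trans (IH i) (leq_addl _ _).
Qed.

(** * Garnir relations and the standard basis of Specht modules *)

Section SpechtBasis.
Variables (C : numFieldType) (lam : seq nat).
Hypothesis lamP : is_partition lam.
Local Notation m := (sumn lam).
Local Notation tableau := {ffun 'I_m -> 'I_m * 'I_m}.
Local Notation polytabloid := (polytabloid C).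
Local Notation tabvec := (tabvec C).
Implicit Types (s u : 'S_m) (t : tableau) (k l : 'I_m).

Lemma nth_partition p q : (p <= q)%N -> (nth 0 lam q <= nth 0 lam p)%N.
Proof.
move=> pq; have [ql|] := ltnP q (size lam); last by move=> ?; rewrite nth_default.
case/andP: lamP => srt _.
have geT : transitive geq by move=> y x z yx zy; apply: leq_trans zy yx.
have geR : reflexive geq by move=> x; apply: leqnn.
by apply: (sorted_leq_nth geT geR 0%N srt); rewrite ?inE // (leq_ltn_trans pq).
Qed.

Lemma in_diagram_le p q p' q' : (p' <= p)%N -> (q' <= q)%N ->
  in_diagram lam p q -> in_diagram lam p' q'.
Proof.
rewrite /in_diagram => /nth_partition pp qq lq.
exact: leq_ltn_trans qq (leq_trans lq pp).
Qed.

Lemma size_partition : (size lam <= m)%N.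
Proof.
case/andP: lamP => _; elim: (lam) => //= a l IH; rewrite inE negb_or => /andP[a0 /IH].
by case: a a0 => // a _ ?; rewrite addSn ltnS (leq_trans _ (leq_addl _ _)).
Qed.

Lemma in_diagram_lt p q : in_diagram lam p q -> (p < m)%N /\ (q < m)%N.
Proof.
rewrite /in_diagram => pq.
have [pl|] := ltnP p (size lam); last by move=> ?; rewrite nth_default in pq.
split; first exact: leq_trans pl size_partition.
exact: leq_trans pq (nth_leq_sumn _ _).
Qed.

Lemma tableau_inj t : is_tableau t -> injective t.
Proof. by case/andP=> /injectiveP. Qed.

Lemma tableau_diagram t k : is_tableau t -> in_diagram lam (t k).1 (t k).2.
Proof.
case/andP=> _ /eqP tE; have : t k \in t @: setT by rewrite imset_f ?inE.
by rewrite tE inE.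
Qed.

Lemma tableau_onto t (b : 'I_m * 'I_m) : is_tableau t ->
  in_diagram lam b.1 b.2 -> exists k, t k = b.
Proof.
case/andP=> _ /eqP tE bl.
have : b \in t @: setT by rewrite tE inE.
by case/imsetP=> k _ ->; exists k.
Qed.

Lemma tableau_actM s u t :
  tableau_act (s * u)%g t = tableau_act u (tableau_act s t).
Proof. by apply/ffunP=> k; rewrite !ffunE invMg permM. Qed.

Lemma col_stab_act s t : s \in col_stab t -> col_stab (tableau_act s t) = col_stab t.
Proof.
rewrite inE => /forallP ts.
have tsV k : (t (s^-1%g k)).2 = (t k).2.
  by rewrite -{2}[k](permKV s); apply/esym/eqP/ts.
apply/setP=> u; rewrite !inE; apply: eq_forallb => k.
by rewrite !ffunE !tsV.
Qed.

Lemma col_stabM s u t : s \in col_stab t -> (s * u \in col_stab t)%g = (u \in col_stab t).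
Proof.
rewrite !inE => /forallP ts; apply/forallP/forallP=> h k; last first.
  by rewrite permM (eqP (h (s k))) ts.
by have := h (s^-1%g k); rewrite permM permKV => /eqP->; rewrite -{2}[k](permKV s) eq_sym.
Qed.

Lemma polytabloid_col_stab s t : s \in col_stab t ->
  polytabloid (tableau_act s t) = (-1) ^+ s *: polytabloid t.
Proof.
move=> st; rewrite /Defs.polytabloid col_stab_act // scaler_sumr.
rewrite [RHS](reindex_inj (mulgI s)) /=; apply: eq_big => [u|u _].
  by rewrite col_stabM.
rewrite scalerA odd_permM signr_addb mulrA -expr2 sqrr_sign mul1r; congr (_ *: tabvec _).
by apply/ffunP=> k; rewrite !ffunE invMg permM.
Qed.

(** After a column permutation [u], the labels of [X] occupy only rows that meet column [j], because
    column [j'] meets no others. There are fewer such rows than labels, so two labels of [X] share a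
    row. Composing with their transposition shows that the inner sum equals its own opposite. *)
Lemma garnir t (X : {set 'I_m}) (j j' : 'I_m) : is_tableau t -> (j < j')%N ->
    (forall k, k \in X -> (t k).2 = j \/ (t k).2 = j') ->
    (#|[set p : 'I_m | in_diagram lam p j]| < #|X|)%N ->
  \sum_(s | perm_on X s) (-1) ^+ s *: polytabloid (tableau_act s t) = 0.
Proof.
move=> tT jj' Xcol cX.
under eq_bigr => s _ do rewrite -polytabloidJ mulmx_suml scaler_sumr.
rewrite exchange_big big1 //= => u; rewrite inE => /forallP tu.
under eq_bigr => s _ do rewrite -scalemxAl tabvecJ scalerA mulrC -scalerA.
rewrite -scaler_sumr; set f := tabloid_act u _.
have [x [y [xX yX nxy fxy]]] :
    exists x y, [/\ x \in X, y \in X, x != y & f x = f y].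
  have : ~~ [forall x in X, forall y in X, (f x == f y) ==> (x == y)].
    apply/negP=> /forall_inP finj.
    have : {in X &, injective f}.
      move=> x y xX yX fxy; apply/eqP.
      by have /forall_inP/(_ y yX) := finj x xX; rewrite fxy eqxx.
    move/card_in_imset=> cf; move: cX; rewrite -cf ltnNge subset_leq_card //.
    apply/subsetP=> _ /imsetP[x xX ->]; rewrite inE !ffunE.
    have := tableau_diagram (u^-1%g x) tT; set k := (u^-1%g x).
    have -> : (t k).2 = (t x).2 by rewrite -[x in RHS](permKV u); apply/esym/eqP/tu.
    by case: (Xcol x xX) => -> //; apply: in_diagram_le => //; apply: ltnW.
  rewrite negb_forall_in => /exists_inP[x xX]; rewrite negb_forall_in.
  case/exists_inP=> y yX; rewrite negb_imply => /andP[/eqP fxy nxy].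
  by exists x, y.
apply/eqP; rewrite scaler_eq0; apply/orP; right.
set S := \sum_(_ | _) _; suff : S = - S.
  move/eqP; rewrite -subr_eq0 opprK -mulr2n -scaler_nat scaler_eq0 pnatr_eq0.
  by case/orP.
rewrite {1}/S (reindex_inj (mulgI (tperm x y))) -sumrN /=.
have txy : perm_on X (tperm x y).
  apply/subsetP=> z; rewrite inE; case: tpermP => [->|->|] //.
  by rewrite eqxx.
apply: eq_big => [s|s _].
  apply/idP/idP => h; last exact: perm_onM.
  by rewrite -[s](mulKg (tperm x y)) tpermV; apply: perm_onM.
rewrite odd_permM odd_tperm nxy signr_addb expr1 mulN1r scaleNr; congr (- (_ *: tabvec _)).
rewrite tabloid_actM; congr tabloid_act; apply/ffunP=> k; rewrite ffunE tpermV.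
by case: tpermP => [->|->|] //.
Qed.

(* The case of a whole column and one further label, with the sum over the
   symmetric group reduced to coset representatives. *)
Lemma garnir1 t (j : 'I_m) (k0 : 'I_m) : is_tableau t -> (j < (t k0).2)%N ->
  \sum_(k | (t k).2 == j) polytabloid (tableau_act (tperm k k0) t) = polytabloid t.
Proof.
move=> tT jk0; pose A := [set k | (t k).2 == j]; pose X := k0 |: A.
have k0A : k0 \notin A by rewrite inE; apply/eqP=> E; rewrite E ltnn in jk0.
have cX : (#|[set p : 'I_m | in_diagram lam p j]| < #|X|)%N.
  rewrite cardsU1 k0A ltnS.
  apply: leq_trans (leq_imset_card (fun k => (t k).1) A).
  apply/subset_leq_card/subsetP=> p; rewrite inE => pj.
  have [k tk] := tableau_onto (b := (p, j)) tT pj.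
  by apply/imsetP; exists k; rewrite ?inE tk.
have Xcol k : k \in X -> (t k).2 = j \/ (t k).2 = (t k0).2.
  by rewrite !inE => /orP[/eqP->|/eqP->]; [right|left].
have := garnir tT jk0 Xcol cX.
(* The permutations of [X] sending [k0] to [l] are the products of a permutation of [A] with
   [tperm l k0]. Permutations of [A] stay inside one column, so all signed terms of a class are
   equal. *)
rewrite (partition_big (fun s => s k0) (mem X)) /=; last first.
  by move=> s sX; rewrite perm_closed ?inE ?eqxx.
have AC s : perm_on A s -> s \in col_stab t.
  move=> sA; rewrite inE; apply/forallP=> k.
  have [kA|kA] := boolP (k \in A); last by rewrite (out_perm sA kA).
  have : s k \in A by rewrite perm_closed.
  by move: kA; rewrite !inE => /eqP-> /eqP->.
have sumE l : l \in X ->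
    \sum_(s | perm_on X s && (s k0 == l)) (-1) ^+ s *: polytabloid (tableau_act s t)
    = #|[set s | perm_on A s]|%:R
        *: ((-1) ^+ (l != k0) *: polytabloid (tableau_act (tperm l k0) t)).
  move=> lX; rewrite (reindex_inj (mulIg (tperm l k0))) /=.
  have tE (x : 'I_m) : (tperm l k0 x == l) = (x == k0).
    by rewrite -{2}(tpermR l k0) (inj_eq perm_inj).
  have tX : perm_on X (tperm l k0).
    apply/subsetP=> z; rewrite inE; case: tpermP => [->|->|] //; rewrite ?eqxx //.
    by move=> _; rewrite !inE eqxx.
  rewrite scaler_nat -sumr_const; apply: eq_big => [s|s]; rewrite ?inE.
    rewrite permM tE; apply/andP/idP.
      case=> sX /eqP sk0; have {}sX : perm_on X s.
        by rewrite -[s](mulgK (tperm l k0)) tpermV perm_onM.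
      apply/subsetP=> z nz; have := subsetP sX z nz; rewrite in_setU1.
      by case/orP=> // /eqP zk; move: nz; rewrite inE zk sk0 eqxx.
    move=> sA; rewrite (out_perm sA k0A) eqxx perm_onM //.
    by apply: subset_trans sA _; apply: subsetUr.
  case/andP=> sX; rewrite permM tE => /eqP sk0.
  have {}sX : perm_on X s.
    by rewrite -[s](mulgK (tperm l k0)) tpermV perm_onM.
  have sC : s \in col_stab t.
    apply: AC; apply/subsetP=> z nz; have := subsetP sX z nz; rewrite in_setU1.
    by case/orP=> // /eqP zk; move: nz; rewrite inE zk sk0 eqxx.
  rewrite tableau_actM -!polytabloidJ polytabloidJ polytabloid_col_stab //.
  rewrite -scalemxAl scalerA odd_permM odd_tperm signr_addb mulrAC -expr2.
  by rewrite sqrr_sign mul1r.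
under eq_bigr => l lX do rewrite sumE //.
rewrite -scaler_sumr => /eqP; rewrite scaler_eq0 pnatr_eq0 => /orP[/eqP/cards0_eq E|].
  have : (1%g : 'S_m) \in [set s | perm_on A s] by rewrite inE perm_on1.
  by rewrite E inE.
rewrite big_setU1 //= eqxx tperm1 scale1r.
have -> : tableau_act 1 t = t by apply/ffunP=> k; rewrite ffunE invg1 perm1.
rewrite (eq_bigr (fun k => - polytabloid (tableau_act (tperm k k0) t))); last first.
  move=> k kA; rewrite (_ : k != k0) ?expr1 ?scaleN1r //.
  by apply: contraNneq k0A => <-.
rewrite sumrN subr_eq0 => /eqP->.
by apply: eq_bigl => k; rewrite inE.
Qed.
End SpechtBasis.

(** * Straightening of polytabloids *)

Section StandardTableaux.
Variables (C : numFieldType) (lam : seq nat).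
Hypothesis lamP : is_partition lam.
Local Notation m := (sumn lam).
Local Notation tableau := {ffun 'I_m -> 'I_m * 'I_m}.
Local Notation polytabloid := (polytabloid C).
Local Notation tabvec := (tabvec C).
Variable v : 'I_m -> nat.
Hypothesis v_inj : injective v.
Implicit Types (s u : 'S_m) (t : tableau) (k l : 'I_m).

Definition standard t := [&& is_tableau t,
  [forall k, forall l, ((t k).1 == (t l).1) && ((t k).2 < (t l).2)%N ==> (v k < v l)%N]
  & [forall k, forall l, ((t k).2 == (t l).2) && ((t k).1 < (t l).1)%N ==> (v k < v l)%N]].

Lemma standard_tableau t : standard t -> is_tableau t.
Proof. by case/and3P. Qed.

Lemma standard_row t k l : standard t -> (t k).1 = (t l).1 ->
  ((t k).2 < (t l).2)%N -> (v k < v l)%N.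
Proof.
case/and3P=> _ /forallP/(_ k)/forallP/(_ l)/implyP h _ e lt.
by apply: h; rewrite e eqxx.
Qed.

Lemma standard_col t k l : standard t -> (t k).2 = (t l).2 ->
  ((t k).1 < (t l).1)%N -> (v k < v l)%N.
Proof.
case/and3P=> _ _ /forallP/(_ k)/forallP/(_ l)/implyP h e lt.
by apply: h; rewrite e eqxx.
Qed.

(** Only the label with the largest [v] is compared: its column is what grades the triangularity of
    the Jucys-Murphy element. *)
Definition col_le t t' :=
  [forall k, [forall l, (v l <= v k)%N] ==> ((t k).2 <= (t' k).2)%N].

Lemma col_le_trans t1 t2 t3 : col_le t1 t2 -> col_le t2 t3 -> col_le t1 t3.
Proof.
move=> /forallP h12 /forallP h23; apply/forallP=> k; apply/implyP=> kM.
exact: leq_trans (implyP (h12 k) kM) (implyP (h23 k) kM).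
Qed.

(* Straightening increases the sum of v k * (column of k), and sorting a
   column, which does not change that sum, increases the sum of v k * (row of k). *)
Let K := ((\sum_k v k) * m).+1.
Let weight t := (\sum_k v k * (K * (t k).2 + (t k).1))%N.

Let weight_bound t : (weight t <= \sum_k v k * (K * m + m))%N.
Proof.
apply: leq_sum => k _; rewrite leq_mul2l leq_add ?orbT //.
  by rewrite leq_mul2l ltnW ?orbT.
exact: ltnW.
Qed.

Let weight_sort t k l : k != l -> (t k).2 = (t l).2 -> ((t k).1 < (t l).1)%N ->
  (v l < v k)%N -> (weight t < weight (tableau_act (tperm k l) t))%N.
Proof.
move=> kl e lt vlk; rewrite /weight.
rewrite (bigD1 k) // (bigD1 l) /=; last by rewrite eq_sym.
rewrite [X in (_ < X)%N](bigD1 k) // [X in (_ < _ + X)%N](bigD1 l) /=;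
  last by rewrite eq_sym.
set S := \sum_(_ | _) _; set S' := \sum_(_ | _) _.
have -> : S' = S.
  apply: eq_bigr => i /andP[ik il]; rewrite !ffunE tpermV tpermD //; by rewrite eq_sym.
rewrite !ffunE tpermV tpermL tpermR e; nia.
Qed.

(** Labels of [X] above [h] start in the left column and the others in the right one. The former can
    only move right and the latter only left, so the column sum weighted by [v] grows. *)
Let weight_garnir t s (X : {set 'I_m}) (h : nat) (j j' : 'I_m) : (j < j')%N ->
  perm_on X s -> s \notin col_stab t ->
  (forall k, k \in X -> ((t k).2 = j /\ (h < v k)%N) \/ ((t k).2 = j' /\ (v k <= h)%N)) ->
  (weight t < weight (tableau_act s t))%N.
Proof.
move=> jj' sX; rewrite inE negb_forall => /existsP[k0 nk0] XP.
pose D k : int := (t (s^-1%g k)).2%:Z - (t k).2%:Z.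
(* Twice the threshold [h + 1/2]. Being odd, it never equals [2 * v k], so the sign of the
   difference tells on which side of the threshold [k] lies. As the [D k] add up to 0, the term in
   [th] drops out of the sum. *)
pose th : int := (2 * h + 1)%:Z.
have D_ge0 k : 0 <= ((2 * v k)%:Z - th) * D k.
  have [kX|kX] := boolP (k \in X); last first.
    have -> : D k = 0 by rewrite /D (out_perm _ kX) ?subrr ?perm_onV.
    by rewrite mulr0.
  have skX : (s^-1)%g k \in X by rewrite perm_closed ?perm_onV.
  rewrite /D /th; case: (XP _ skX) (XP _ kX) => [] [-> ?] [] [-> ?]; nia.
have sumD : \sum_k D k = 0.
  by rewrite sumrB (reindex_inj (@perm_inj _ s)) /=;
    under eq_bigr => i _ do rewrite permK; rewrite subrr.
have D_gt0 : 0 < \sum_k ((2 * v k)%:Z - th) * D k.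
  rewrite (bigD1 (s k0)) //= ltr_pwDl ?sumr_ge0 //.
  rewrite lt0r D_ge0 andbT mulf_neq0 //.
    by rewrite /th; apply/eqP; lia.
  by rewrite /D permK subr_eq0 eqz_nat eq_sym.
have {D_gt0} D_gt0 : 0 < \sum_k (v k)%:Z * D k.
  rewrite -(pmulr_rgt0 _ (isT : 0 < 2%:Z)) mulr_sumr.
  move: D_gt0; under eq_bigr => k _ do rewrite mulrBl.
  rewrite sumrB -[\sum_k th * _]mulr_sumr sumD mulr0 subr0.
  by under eq_bigr => k _ do rewrite PoszM -mulrA.
have colE : (\sum_k v k * (t k).2 < \sum_k v k * (tableau_act s t k).2)%N.
  have toZ (f : 'I_m -> nat) : (\sum_k v k * f k)%N%:Z = \sum_k (v k)%:Z * (f k)%:Z.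
    by elim/big_rec2: _ => // i x y _ <-.
  rewrite -ltz_nat -subr_gt0 !toZ -sumrB; congr (is_true (_ < _)): D_gt0.
  by apply: eq_bigr => k _; rewrite /D ffunE mulrBr.
have weightE t' : weight t' = (K * \sum_k v k * (t' k).2 + \sum_k v k * (t' k).1)%N.
  by rewrite /weight big_distrr -big_split /=; apply: eq_bigr => k _; lia.
(* [K] exceeds every possible row part, so a gain of one in the column part outweighs any loss in
   the rows. *)
have rows_lt t' : (\sum_k v k * (t' k).1 < K)%N.
  rewrite ltnS big_distrl /=; apply: leq_sum => k _.
  by rewrite leq_mul2l ltnW ?orbT.
rewrite !weightE; have := rows_lt t; nia.
Qed.

(** Induction on the gap between the weight and its bound. A column descent is removed by a
    transposition, at the cost of a sign. Once the columns increase, a row descent is removed by a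
    Garnir relation whose other terms are all heavier. *)
Lemma straighten t : is_tableau t ->
  (polytabloid t <= \sum_(s | standard s && col_le t s) <<polytabloid s>>)%MS.
Proof.
pose b := (\sum_k v k * (K * m + m))%N.
have [n] := ubnP (b - weight t)%N; elim: n t => // n IH t; rewrite ltnS => wn tT.
have IH' t' : is_tableau t' -> (weight t < weight t')%N -> col_le t t' ->
    (polytabloid t' <= \sum_(s | standard s && col_le t s) <<polytabloid s>>)%MS.
  move=> tT' wt cle; have wt' := weight_bound t'.
  apply: submx_trans (IH _ _ tT') _; first by rewrite -/b in wt'; lia.
  apply/sumsmx_subP=> s /andP[ss cs]; apply: (sumsmx_sup s) => //.
  by rewrite ss (col_le_trans cle).
have [st|] := boolP (standard t).
  apply: (sumsmx_sup t); rewrite ?genmxE // st.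
  by apply/forallP=> k; apply/implyP.
have tI := tableau_inj tT.
have [colt|] := boolP [forall k, forall l, ((t k).2 == (t l).2) && ((t k).1 < (t l).1)%N
  ==> (v k < v l)%N]; last first.
  rewrite negb_forall => /existsP[k]; rewrite negb_forall => /existsP[l].
  rewrite negb_imply -leqNgt => /andP[/andP[/eqP ekl lkl]] vlk _.
  have nkl : k != l by apply: contraTneq lkl => ->; rewrite ltnn.
  have kC : tperm k l \in col_stab t.
    by rewrite inE; apply/forallP=> x; case: tpermP => [->|->|]; rewrite ?ekl.
  have := polytabloid_col_stab C kC.
  rewrite odd_tperm nkl expr1 scaleN1r => e.
  rewrite -[polytabloid t]opprK -e eqmx_opp; apply: IH'.
  - exact: is_tableau_act.
  - apply: weight_sort => //.
    by rewrite ltn_neqAle vlk andbT (inj_eq v_inj) eq_sym.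
  - apply/forallP=> x; apply/implyP=> _; rewrite ffunE tpermV.
    by case: tpermP => [->|->|]; rewrite ?ekl.
rewrite /standard tT /= colt andbT.
rewrite negb_forall => /existsP[k]; rewrite negb_forall => /existsP[l].
rewrite negb_imply -leqNgt => /andP[/andP[/eqP ekl lkl]] vlk.
have col_inc x y : (t x).2 = (t y).2 -> (v x <= v y)%N -> ((t x).1 <= (t y).1)%N.
  move=> e; apply: contraTT; rewrite -!ltnNge => yx.
  by have /forallP/(_ y)/forallP/(_ x)/implyP := colt; apply; rewrite e eqxx.
have {}vlk : (v l < v k)%N.
  by rewrite ltn_neqAle vlk andbT (inj_eq v_inj); apply: contraTneq lkl => ->; rewrite ltnn.
(* The Garnir set of the descent: the left column from [k] downwards and the right column from [l]
   upwards. Both parts contain the row of the descent, so together they outnumber the left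
   column. *)
pose A := [set x | ((t x).2 == (t k).2) && ((t k).1 <= (t x).1)%N].
pose B := [set x | ((t x).2 == (t l).2) && ((t x).1 <= (t l).1)%N].
have colA x : x \in A -> (t x).2 = (t k).2 /\ (v l < v x)%N.
  rewrite inE => /andP[/eqP e le]; split=> //; apply: leq_trans vlk _.
  rewrite leqNgt; apply/negP=> lt; have := col_inc _ _ e (ltnW lt).
  move=> le'; have exk : t x = t k.
    by apply/eqP; rewrite -pair_eqE /pair_eq /= e eqxx andbT -val_eqE eqn_leq le le'.
  by move: lt; rewrite (tI _ _ exk) ltnn.
have colB x : x \in B -> (t x).2 = (t l).2 /\ (v x <= v l)%N.
  rewrite inE => /andP[/eqP e le]; split=> //.
  rewrite leqNgt; apply/negP=> lt; have := col_inc _ _ (esym e) (ltnW lt).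
  move=> le'; have exk : t x = t l.
    by apply/eqP; rewrite -pair_eqE /pair_eq /= e eqxx andbT -val_eqE eqn_leq le le'.
  by move: lt; rewrite (tI _ _ exk) ltnn.
pose X := A :|: B.
have XP x : x \in X -> ((t x).2 = (t k).2 /\ (v l < v x)%N) \/ ((t x).2 = (t l).2 /\ (v x
  <= v l)%N).
  by rewrite inE => /orP[/colA|/colB]; [left|right].
have cX : (#|[set p : 'I_m | in_diagram lam p (t k).2]| < #|X|)%N.
  pose RA := [set p : 'I_m | in_diagram lam p (t k).2 & ((t k).1 <= p)%N].
  pose RB := [set p : 'I_m | (p <= (t k).1)%N].
  have dl := tableau_diagram l tT; have dk := tableau_diagram k tT.
  have cA : (#|RA| <= #|A|)%N.
    apply: leq_trans (leq_imset_card (fun x => (t x).1) A).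
    apply/subset_leq_card/subsetP=> p; rewrite inE => /andP[pd kp].
    have [x tx] := tableau_onto (b := (p, (t k).2)) tT pd.
    by apply/imsetP; exists x; rewrite ?inE tx ?eqxx.
  have cB : (#|RB| <= #|B|)%N.
    apply: leq_trans (leq_imset_card (fun x => (t x).1) B).
    apply/subset_leq_card/subsetP=> p; rewrite inE => kp.
    have pd : in_diagram lam p (t l).2.
      by apply: (in_diagram_le lamP _ _ dl) => //; rewrite -ekl.
    have [x tx] := tableau_onto (b := (p, (t l).2)) tT pd.
    by apply/imsetP; exists x; rewrite ?inE tx ?eqxx -?ekl.
  have dAB : A :&: B = set0.
    apply/setP=> x; rewrite in_setI [RHS]inE; apply/andP=> -[/colA[e _] /colB[e' _]].
    by move: lkl; rewrite -e e' ltnn.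
  have := cardsUI A B; rewrite -/X dAB cards0 addn0 => ->.
  apply: leq_trans (leq_add cA cB); rewrite -cardsUI -addn1 leq_add //.
    apply/subset_leq_card/subsetP=> p; rewrite !inE => ->.
    by rewrite leq_total.
  rewrite card_gt0; apply/set0Pn; exists (t k).1.
  by rewrite !inE dk !leqnn.
have Xcol x : x \in X -> (t x).2 = (t k).2 \/ (t x).2 = (t l).2.
  by case/XP=> -[]; [left|right].
have := garnir C lamP tT lkl Xcol cX.
(* The permutations of [X] that preserve columns give back [polytabloid t], their two signs
   cancelling. There are [N] of them, and [N] is invertible in characteristic zero. *)
rewrite (bigID (mem (col_stab t))) /=.
rewrite (eq_bigr (fun _ => polytabloid t)); last first.
  by move=> s /andP[_ sC]; rewrite polytabloid_col_stab // scalerA -expr2 sqrr_sign scale1r.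
rewrite sumr_const -scaler_nat => /eqP; rewrite addr_eq0 => /eqP.
set N := #|_| => E.
have N0 : N%:R != 0 :> C.
  rewrite pnatr_eq0 -lt0n; apply/card_gt0P; exists 1%g.
  by rewrite unfold_in /= perm_on1 inE; apply/forallP=> x; rewrite perm1.
rewrite -(eqmx_scale _ N0) E eqmx_opp; apply: summx_sub => s /andP[sX sC].
apply: scalemx_sub; apply: IH'; first exact: is_tableau_act.
  exact: weight_garnir lkl sX sC XP.
apply/forallP=> x; apply/implyP=> /forallP xM; rewrite ffunE.
have [xX|xX] := boolP (x \in X); last by rewrite (out_perm _ xX) ?perm_onV.
(* The largest label exceeds [l], so if it belongs to [X] it belongs to [A]: it sits in the left
   column and can only move right. *)
have -> : (t x).2 = (t k).2.
  by case: (XP x xX) => -[-> //] lx; have := leq_trans (xM k) lx; rewrite leqNgt vlk.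
have : (s^-1)%g x \in X by rewrite perm_closed ?perm_onV.
by case/Xcol=> -> //; apply: ltnW.
Qed.
End StandardTableaux.

(** * Linear independence of the standard polytabloids *)

Lemma sum_digits_lt (I : finType) (v f : I -> nat) (b h : nat) : injective v ->
  (0 < b)%N -> (forall k, (f k < b)%N) ->
  (\sum_(k | (v k < h)%N) f k * b ^ v k < b ^ h)%N.
Proof.
move=> v_inj b_gt0 fb; elim: h => [|h IH]; first by rewrite big_pred0.
have [k /eqP vk|nv] := pickP (fun k => v k == h).
  rewrite (bigD1 k) /=; last by rewrite vk.
  rewrite (eq_bigl (fun l => (v l < h)%N)); last first.
    by move=> l; rewrite ltnS ltn_neqAle -vk (inj_eq v_inj) andbC.
  by rewrite vk expnS; have := fb k; nia.
rewrite (eq_bigl (fun l => (v l < h)%N)); last first.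
  by move=> l; rewrite ltnS leq_eqVlt nv.
by apply: leq_trans IH _; rewrite leq_pexp2l.
Qed.

Lemma card_ord_lt (m p : nat) : (p <= m)%N -> #|[set q : 'I_m | (q < p)%N]| = p.
Proof.
move=> pm; have wI : injective (widen_ord pm) by move=> x y /(congr1 val)/= /val_inj.
rewrite -[RHS]card_ord -(card_imset _ wI); apply: eq_card => q.
rewrite inE; apply/idP/imsetP => [qp|[x _ ->]]; last exact: (ltn_ord x).
by exists (Ordinal qp) => //; apply: val_inj.
Qed.

Section StandardBasis.
Variables (C : numFieldType) (lam : seq nat).
Hypothesis lamP : is_partition lam.
Local Notation m := (sumn lam).
Local Notation tableau := {ffun 'I_m -> 'I_m * 'I_m}.
Local Notation polytabloid := (polytabloid C).
Local Notation tabvec := (tabvec C).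
Variable v : 'I_m -> nat.
Hypothesis v_inj : injective v.
Local Notation standard := (standard v).
Implicit Types (s u : 'S_m) (t : tableau) (k l : 'I_m).

(** The boxes to the left of [k] in its row hold exactly the smaller labels of that row. The rows of
    all labels therefore give their columns, so a standard tableau is determined by its tabloid. *)
Lemma standard_colE t k : standard t ->
  (t k).2 = #|[set l | (t l).1 == (t k).1 & (v l < v k)%N]| :> nat.
Proof.
move=> st; have tT := standard_tableau st; have tI := tableau_inj tT.
set A := [set l | _ & _]; rewrite -(card_ord_lt (ltnW (ltn_ord (t k).2))).
have inj : {in A &, injective (fun l => (t l).2)}.
  move=> x y; rewrite !inE => /andP[/eqP ex _] /andP[/eqP ey _] e.
  by apply: tI; apply/eqP; rewrite -pair_eqE /pair_eq /= e ex ey !eqxx.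
rewrite -(card_in_imset inj); apply: eq_card => q; rewrite inE.
apply/idP/imsetP => [qk|[x]]; last first.
  rewrite inE => /andP[/eqP e vx] ->; rewrite ltnNge leq_eqVlt;
    apply/negP=> /orP[/eqP/val_inj e'|lt].
    suff xk : x = k by rewrite xk ltnn in vx.
    by apply: tI; apply/eqP; rewrite -pair_eqE /pair_eq /= e e' !eqxx.
  by have := standard_row st (esym e) lt; rewrite ltnNge ltnW.
have qd : in_diagram lam (t k).1 q.
  by apply: (in_diagram_le lamP _ _ (tableau_diagram k tT)) => //; apply: ltnW.
have [x tx] := tableau_onto (b := ((t k).1, q)) tT qd.
exists x; rewrite ?inE tx ?eqxx //=; apply: (standard_row st); by rewrite tx.
Qed.

Lemma standard_rowE t k : standard t ->
  (t k).1 = #|[set l | (t l).2 == (t k).2 & (v l < v k)%N]| :> nat.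
Proof.
move=> st; have tT := standard_tableau st; have tI := tableau_inj tT.
set A := [set l | _ & _]; rewrite -(card_ord_lt (ltnW (ltn_ord (t k).1))).
have inj : {in A &, injective (fun l => (t l).1)}.
  move=> x y; rewrite !inE => /andP[/eqP ex _] /andP[/eqP ey _] e.
  by apply: tI; apply/eqP; rewrite -pair_eqE /pair_eq /= e ex ey !eqxx.
rewrite -(card_in_imset inj); apply: eq_card => q; rewrite inE.
apply/idP/imsetP => [qk|[x]]; last first.
  rewrite inE => /andP[/eqP e vx] ->; rewrite ltnNge leq_eqVlt;
    apply/negP=> /orP[/eqP/val_inj e'|lt].
    suff xk : x = k by rewrite xk ltnn in vx.
    by apply: tI; apply/eqP; rewrite -pair_eqE /pair_eq /= e e' !eqxx.
  by have := standard_col st (esym e) lt; rewrite ltnNge ltnW.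
have qd : in_diagram lam q (t k).2.
  by apply: (in_diagram_le lamP _ _ (tableau_diagram k tT)) => //; apply: ltnW.
have [x tx] := tableau_onto (b := (q, (t k).2)) tT qd.
exists x; rewrite ?inE tx ?eqxx //=; apply: (standard_col st); by rewrite tx.
Qed.

Lemma standard_tabloid_inj t t' : standard t -> standard t' ->
  tabloid t = tabloid t' -> t = t'.
Proof.
move=> st st' /ffunP e; have rE k : (t k).1 = (t' k).1 by have := e k; rewrite !ffunE.
apply/ffunP=> k; apply/eqP; rewrite -pair_eqE /pair_eq /= rE eqxx /=.
rewrite -val_eqE /= (standard_colE k st) (standard_colE k st'); apply/eqP.
by apply: eq_card => l; rewrite !inE !rE.
Qed.

(** The rows are read as base-[m] digits, that of [k] at place [v k]. This orders tabloids
    lexicographically, the largest label counting first. *)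
Let tabloid_weight (f : rowfun lam) : nat := (\sum_k f k * m ^ v k)%N.

Lemma tabloid_weight_lt (f g : rowfun lam) k : (f k < g k)%N ->
  (forall l, (v k < v l)%N -> f l = g l) -> (tabloid_weight f < tabloid_weight g)%N.
Proof.
move=> fg e; have m_gt0 : (0 < m)%N by apply: leq_ltn_trans (ltn_ord k).
have split_sum h : tabloid_weight h = (\sum_(l | (v l < v k)%N) h l * m ^ v l
    + (h k * m ^ v k + \sum_(l | (v k < v l)%N) h l * m ^ v l))%N.
  rewrite /tabloid_weight (bigID (fun l => (v l < v k)%N)) /=; congr (_ + _)%N.
  rewrite (bigD1 k) /= ?ltnn //; congr (_ + _)%N; apply: eq_bigl => l.
  by rewrite -leqNgt ltn_neqAle (inj_eq v_inj) eq_sym andbC.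
have eq_gt : (\sum_(l | (v k < v l)%N) f l * m ^ v l = \sum_(l | (v k < v l)%N) g l * m ^
  v l)%N.
  by apply: eq_bigr => l /e->.
have lo := sum_digits_lt (v k) v_inj m_gt0 (fun l => ltn_ord (f l)).
rewrite !split_sum eq_gt addnA [X in (_ < X)%N]addnA ltn_add2r.
apply: leq_trans (leq_addl _ _); apply: leq_trans (_ : (f k).+1 * m ^ v k <= _)%N.
  by rewrite mulSn ltn_add2r.
by rewrite leq_mul2r fg orbT.
Qed.

(** Let [k] be the largest label moved by [s]. Its new row is that of a smaller label of the same
    column, hence an earlier row, while all larger labels keep theirs. *)
Lemma tabloid_weight_act t s : standard t -> s \in col_stab t -> s != 1%g ->
  (tabloid_weight (tabloid_act s (tabloid t)) < tabloid_weight (tabloid t))%N.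
Proof.
move=> st; rewrite inE => /forallP sC s1.
have [k0 nk0] : exists k, s k != k.
  by apply/existsP; apply: contraNT s1 => /existsPn h; apply/eqP/permP=> k;
     rewrite perm1; apply/eqP; have := h k; rewrite negbK.
case: (@arg_maxnP _ k0 (fun k => s k != k) v nk0) => k nk kM.
have fixl l : (v k < v l)%N -> (s^-1%g l) = l.
  move=> lt; apply: (@perm_inj _ s); rewrite permKV; apply/eqP; rewrite eq_sym.
  by apply: contraLR lt; rewrite -leqNgt; apply: kM.
have ns : (s^-1%g k) != k by rewrite -(inj_eq (@perm_inj _ s)) permKV eq_sym.
have vs : (v (s^-1%g k) < v k)%N.
  rewrite ltn_neqAle (inj_eq v_inj) ns /=; apply: kM.
  by rewrite /= permKV eq_sym.
have ec : (t (s^-1%g k)).2 = (t k).2.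
  by rewrite -[k in RHS](permKV s); apply/esym/eqP/sC.
apply: (@tabloid_weight_lt _ _ k) => [|l kl]; rewrite !ffunE; last by rewrite fixl.
rewrite ltn_neqAle; apply/andP; split.
  apply: contraNneq ns => /val_inj er; apply/eqP;
    apply: (tableau_inj (standard_tableau st)).
  by apply/eqP; rewrite -pair_eqE /pair_eq /= er ec !eqxx.
rewrite leqNgt; apply/negP=> lt; have := standard_col st (esym ec) lt.
by rewrite ltnNge ltnW.
Qed.

(** The tabloid of a standard [t] is the heaviest one in [polytabloid t]. In a linear relation, take
    among the nonzero coefficients one with the heaviest tabloid: this tabloid occurs in no other
    term. *)
Lemma polytabloid_free N (tab : 'I_N -> tableau) : injective tab ->
  (forall i, standard (tab i)) -> row_free (\matrix_i polytabloid (tab i)).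
Proof.
move=> tabI tabS; rewrite -kermx_eq0; apply/rowV0P=> u /sub_kermxP uP.
apply/eqP/negPn/negP=> /matrix0Pn[i0 [j0]]; rewrite ord1 => nj0.
case: (@arg_maxnP _ j0 (fun j => u 0 j != 0) (fun j =>
  tabloid_weight (tabloid (tab j))) nj0) => i ui iM.
have := congr1 (fun w : 'rV_ _ => w 0 (enum_rank (tabloid (tab i)))) uP.
rewrite !mxE (bigD1 i) //= big1 => [|j ji].
  rewrite addr0 !mxE /Defs.polytabloid summxE (bigD1 1%g) /=; last first.
    by rewrite inE; apply/forallP=> k; rewrite perm1.
  rewrite big1 => [|s /andP[sC s1]].
    rewrite addr0 odd_perm1 expr0 !mxE tabloid_act1 !eqxx /= !mulr1.
    by move/eqP; rewrite (negPf ui).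
  rewrite !mxE eqxx (inj_eq enum_rank_inj) /=.
  have := tabloid_weight_act (tabS i) sC s1.
  by case: eqP => [e|_ _]; [rewrite -e ltnn | rewrite mulr0].
have [->|uj] := eqVneq (u 0 j) 0; first by rewrite mul0r.
rewrite !mxE /Defs.polytabloid summxE big1 ?mulr0 // => s sC.
rewrite !mxE eqxx (inj_eq enum_rank_inj) /=; case: eqP; rewrite ?mulr0 // => e.
have [s1|s1] := eqVneq s 1%g.
  move: e; rewrite s1 tabloid_act1 => /(standard_tabloid_inj (tabS _) (tabS _))/tabI E.
  by rewrite E eqxx in ji.
have := tabloid_weight_act (tabS j) sC s1; rewrite -e ltnNge.
by have -> := iM j uj : (_ <= _)%N.
Qed.

(** Independence and straightening make the standard polytabloids a basis. Through this equality the
    matrix indices of [specht_repr] can name standard tableaux, as [std_tab] does. *)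
Lemma standard_rank : #|[set t | standard t]| = \rank (specht_mx C lam).
Proof.
pose tab (i : 'I_#|[set t | standard t]|) : tableau := enum_val i.
have tabS i : standard (tab i) by have := enum_valP i; rewrite inE.
have free := polytabloid_free enum_val_inj tabS.
rewrite -[LHS](eqP free); apply: eqmx_rank; apply/andP; split.
  apply/row_subP=> i; rewrite rowK; apply: (sumsmx_sup (tab i)); rewrite ?genmxE //.
  exact: standard_tableau.
apply/sumsmx_subP=> t tT; rewrite genmxE.
apply: submx_trans (straighten C lamP v_inj tT) _.
apply/sumsmx_subP=> s /andP[ss _]; rewrite genmxE.
have sS : s \in [set t | standard t] by rewrite inE.
rewrite (_ : polytabloid s = row (enum_rank_in sS s) (\matrix_i polytabloid (tab i)))
  ?row_sub //.
by rewrite rowK /tab enum_rankK_in.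
Qed.

Definition std_tab (i : 'I_(\rank (specht_mx C lam))) : tableau :=
  enum_val (cast_ord (esym standard_rank) i).

Lemma std_tabP i : standard (std_tab i).
Proof. by have := enum_valP (cast_ord (esym standard_rank) i); rewrite inE. Qed.

Lemma std_tab_inj : injective std_tab.
Proof. by move=> i j /enum_val_inj/cast_ord_inj. Qed.

Lemma std_tab_onto t : standard t -> exists i, std_tab i = t.
Proof.
move=> st; have sS : t \in [set t | standard t] by rewrite inE.
by exists (cast_ord standard_rank (enum_rank_in sS t));
  rewrite /std_tab cast_ordK enum_rankK_in.
Qed.

Definition std_mx : 'M[C]_(_, #|rowfun lam|) := \matrix_i polytabloid (std_tab i).

Lemma std_mx_sub : (std_mx <= specht_mx C lam)%MS.
Proof.
apply/row_subP=> i; rewrite rowK; apply: (sumsmx_sup (std_tab i)); rewrite ?genmxE //.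
exact/standard_tableau/std_tabP.
Qed.

(** The rows are the coordinates of the standard polytabloids in the row basis underlying
    [specht_repr], so this is the change of basis. *)
Definition std_coord : 'M[C]_(\rank (specht_mx C lam)) := in_submod _ std_mx.

Lemma std_coord_unit : std_coord \in unitmx.
Proof.
rewrite -row_free_unit -row_leq_rank.
have /eqP free := polytabloid_free std_tab_inj std_tabP.
apply: leq_trans (_ : \rank std_mx <= _)%N; first by rewrite free.
by rewrite -[X in (\rank X <= _)%N](in_submodK std_mx_sub) val_submodE mxrankM_maxl.
Qed.

Lemma sum_polytabloid_coord (P : pred tableau) (w : 'rV_#|rowfun lam|) :
  (forall t, P t -> standard t) -> (w <= \sum_(t | P t) <<polytabloid t>>)%MS ->
  exists a : 'rV_(\rank (specht_mx C lam)),
    w = a *m std_mx /\ (forall j, ~~ P (std_tab j) -> a 0 j = 0).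
Proof.
move=> PS /sub_sumsmxP[u ->].
elim/big_rec: _ => [|t w' Pt [a [-> aP]]].
  by exists 0; split=> [|j _]; rewrite ?mul0mx ?mxE.
have : (u t *m <<polytabloid t>> <= polytabloid t)%MS by rewrite (submx_trans (submxMl _
  _)) ?genmxE.
case/sub_rVP=> b ->; have [i ti] := std_tab_onto (PS t Pt).
exists (b *: delta_mx 0 i + a); split=> [|j Pj].
  by rewrite mulmxDl -scalemxAl -rowE rowK ti.
by rewrite !mxE aP // addr0 eqxx /=; case: eqP => [E|]; rewrite ?mulr0 //;
  rewrite E ti Pt in Pj.
Qed.

(** * Triangular action of the Jucys-Murphy element *)

Lemma jucys_murphy_polytabloid k0 t : (forall k, (v k <= v k0)%N) -> standard t ->
  exists2 w, polytabloid t *m (\sum_(k | k != k0) tabloid_mx C (tperm k k0))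
    = (((t k0).2)%:Z - ((t k0).1)%:Z)%:~R *: polytabloid t + w
  & (w <= \sum_(s | standard s && ((t k0).2 < (s k0).2)%N) <<polytabloid s>>)%MS.
Proof.
move=> k0M st; have tT := standard_tableau st.
rewrite mulmx_sumr (eq_bigr (fun k => polytabloid (tableau_act (tperm k k0) t)));
  last first.
  by move=> k _; rewrite polytabloidJ.
rewrite (bigID (fun k => ((t k).2 < (t k0).2)%N)) /=.
rewrite [X in _ + X](bigID (fun k => (t k).2 == (t k0).2)) /=.
rewrite [X in _ + (X + _)](eq_bigr (fun=> - polytabloid t)); last first.
  move=> k /andP[/andP[nk _] /eqP e].
  have kC : tperm k k0 \in col_stab t.
    by rewrite inE; apply/forallP=> x; case: tpermP => [->|->|]; rewrite ?e.
  by rewrite polytabloid_col_stab // odd_tperm nk expr1 scaleN1r.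
rewrite sumr_const addrA; set w := \sum_(_ | _ && ~~ (_ == _)) _; exists w; last first.
  (* Here [k] lies to the right of [k0]. The swap moves [k0] into the column of [k], and
     straightening never brings the largest label back to the left. *)
  apply: summx_sub => k /andP[/andP[nk ck] nck].
  apply: submx_trans (straighten C lamP v_inj (is_tableau_act _ tT)) _.
  apply/sumsmx_subP=> s /andP[ss /forallP/(_ k0)/implyP cs]; apply: (sumsmx_sup s) => //.
  rewrite ss /=; move: cs; rewrite ffunE tpermV tpermR => cs.
  have {}cs := cs (introT forallP k0M).
  by apply: leq_trans cs; rewrite ltn_neqAle eq_sym nck leqNgt.
congr (_ + _); rewrite mulrzBr -!pmulrn scalerBl !scaler_nat; congr (_ + _).
  (* By [garnir1] each column to the left of [k0] contributes one copy of [polytabloid t]. Columns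
     are numbered from 0, so there are [(t k0).2] of them. *)
  rewrite (partition_big (fun k => (t k).2) (fun j : 'I_m => (j < (t k0).2)%N)) /=;
    last first.
    by move=> k /andP[].
  rewrite (eq_bigr (fun=> polytabloid t)) => [|j jk].
    rewrite sumr_const; congr (_ *+ _).
    by rewrite -[RHS](card_ord_lt (ltnW (ltn_ord (t k0).2))); apply: eq_card => q;
      rewrite inE.
  rewrite -[RHS](garnir1 C lamP tT jk); apply: eq_bigl => k.
  have [E|] := eqVneq (t k).2 j; rewrite ?andbF ?andbT // E jk andbT.
  by apply: contraTneq jk => Ek; rewrite -E Ek ltnn.
(* As [k0] is the largest label, the other labels of its column are exactly those counted by
   [standard_rowE]. *)
rewrite mulNrn; congr (- (_ *+ _)); rewrite (standard_rowE k0 st) cardsE.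
apply: eq_card => k; rewrite !unfold_in /=; have [E|] := eqVneq (t k).2 (t k0).2;
  rewrite ?andbF //.
by rewrite E ltnn !andbT ltn_neqAle k0M andbT (inj_eq v_inj).
Qed.

Lemma jucys_murphy_triangular k0 : (forall k, (v k <= v k0)%N) ->
  exists T : 'M[C]_(\rank (specht_mx C lam)),
  [/\ std_coord *m (\sum_(k | k != k0) specht_repr C lam (tperm k k0)) = T *m std_coord,
      forall i, T i i = (((std_tab i k0).2)%:Z - ((std_tab i k0).1)%:Z)%:~R
    & forall i j, T i j != 0 -> i = j \/ ((std_tab i k0).2 < (std_tab j k0).2)%N].
Proof.
move=> k0M.
have rowP i : exists a : 'rV_(\rank (specht_mx C lam)),
   [/\ row i std_mx *m (\sum_(k | k != k0) tabloid_mx C (tperm k k0)) = a *m std_mx,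
    a 0 i = (((std_tab i k0).2)%:Z - ((std_tab i k0).1)%:Z)%:~R
    & forall j, a 0 j != 0 -> i = j \/ ((std_tab i k0).2 < (std_tab j k0).2)%N].
  have [w e ws] := jucys_murphy_polytabloid k0M (std_tabP i).
  have [|a [wa aP]] := sum_polytabloid_coord _ ws; first by move=> t /andP[].
  set c : C := _%:~R in e *.
  exists (c *: delta_mx 0 i + a); split=> [||j].
  - by rewrite rowK e mulmxDl -scalemxAl -rowE rowK wa.
  - by rewrite !mxE !eqxx mulr1 aP ?addr0 // ltnn andbF.
  - rewrite !mxE eqxx /=; have [->|_] := eqVneq j i; first by left.
    rewrite mulr0 add0r => aj; right; move: aj; apply: contraNT => nlt.
    by rewrite aP // negb_and nlt orbT.
have [a aP] := fin_all_exists rowP.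
exists (\matrix_i a i); split=> [|i|i j]; last 2 first.
- by rewrite mxE; case: (aP i).
- by rewrite mxE; case: (aP i) => _ _; apply.
rewrite mulmx_sumr (eq_bigr (fun k =>
  in_submod (specht_mx C lam) (std_mx *m tabloid_mx C (tperm k k0)))).
  rewrite -linear_sum -mulmx_sumr /=.
  rewrite (_ : std_mx *m _ = (\matrix_i a i) *m std_mx).
    by rewrite /std_coord in_submodE -mulmxA -in_submodE.
  by apply/row_matrixP=> i; rewrite !row_mul rowK; case: (aP i).
move=> k _; rewrite /std_coord.
by rewrite (in_submodJ (specht_module C lam)) ?inE // std_mx_sub.
Qed.

End StandardBasis.

(** * Schur orthogonality *)

Section Average.
Variables (C : fieldType) (gT : finGroupType) (n1 n2 : nat).
Variables (r1 : mx_representation C [set: gT] n1) (r2 : mx_representation C [set: gT] n2).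

(** Summing over the group turns any matrix into an intertwiner. On a matrix unit the entries are
    the sums of the orthogonality relations. *)
Definition rep_avg (X : 'M_(n1, n2)) := \sum_g r1 g *m X *m r2 g^-1%g.

Lemma rep_avgJ X g : r1 g *m rep_avg X = rep_avg X *m r2 g.
Proof.
rewrite mulmx_sumr mulmx_suml (reindex_inj (mulgI g^-1%g)) /=.
apply: eq_bigr => h _; rewrite !mulmxA -repr_mxM ?inE // mulKVg.
by rewrite invMg invgK repr_mxM ?inE // mulmxA.
Qed.

Lemma rep_avg_delta a b c d :
  rep_avg (delta_mx b c) a d = \sum_g r1 g a b * r2 g^-1%g c d.
Proof.
rewrite summxE; apply: eq_bigr => g _; rewrite -mulmxA mxE (bigD1 b) //= big1 => [|i ib].
  rewrite addr0 mxE (bigD1 c) //= big1 => [|j jc]; first by rewrite mxE !eqxx mul1r addr0.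
  by rewrite mxE (negPf jc) andbF mul0r.
by rewrite mxE big1 ?mulr0 // => j _; rewrite mxE (negPf ib) mul0r.
Qed.

End Average.

Lemma trace_rep_avg_delta (C : fieldType) (gT : finGroupType) n
    (r : mx_representation C [set: gT] n) b c :
  \tr (rep_avg r r (delta_mx b c)) = #|gT|%:R * (b == c)%:R.
Proof.
rewrite linear_sum /= (eq_bigr (fun=> (b == c)%:R)) => [|g _].
  by rewrite sumr_const mulr_natl.
rewrite mxtrace_mulC mulmxA -repr_mxM ?inE // mulVg repr_mx1 mul1mx.
rewrite /mxtrace (bigD1 b) //= big1 => [|i ib]; first by rewrite mxE eqxx addr0.
by rewrite mxE (negPf ib).
Qed.

Section SchurOrthogonality.
Variables (C : numClosedFieldType) (gT : finGroupType) (sG : irrType C [set: gT]).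
Implicit Types sigma tau : sG.
Local Notation W sigma := (irr_repr sigma).
Local Notation dim sigma := (irr_degree sigma).

Let pcharG : pgroup [pchar C]^' [set: gT].
Proof. by apply/pgroupP=> p pr _ /=; rewrite inE /= pchar_num. Qed.

(** Schur's lemma: kernel and image of [f] are submodules, so a nonzero [f] would be an isomorphism,
    and [sG] lists each class only once. *)
Lemma irr_intertwiner0 sigma tau (f : 'M_(dim sigma, dim tau)) : sigma != tau ->
  (forall g, W sigma g *m f = f *m W tau g) -> f = 0.
Proof.
move=> nst fW; apply/eqP/negPn/negP=> nf.
have kf : row_free f.
  rewrite -kermx_eq0; apply/negPn/negP=> nk.
  have /mx_irrP[_ irr] := socle_irr sigma.
  have modk : mxmodule (W sigma) (kermx f).
    by apply/mxmoduleP=> g _; apply/sub_kermxP; rewrite -mulmxA fW mulmxA mulmx_ker mul0mx.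
  have := irr _ modk nk; rewrite -sub1mx => /sub_kermxP; rewrite mul1mx => f0.
  by rewrite f0 eqxx in nf.
have ff : row_full f.
  have /mx_irrP[_ irr] := socle_irr tau.
  have modf : mxmodule (W tau) <<f>>%MS.
    apply/mxmoduleP=> g _; rewrite (eqmxMr _ (genmxE _)) genmxE -fW; exact: submxMl.
  have := irr _ modf; rewrite (eqmx_eq0 (genmxE _)) => /(_ nf).
  by rewrite /row_full mxrank_gen.
have e : dim sigma = dim tau by rewrite -(eqP kf) (eqP ff).
have : mx_rsim (W sigma) (W tau) by exists f => // x _; apply: fW.
move/(irr_comp_rsim_pchar sG pcharG); rewrite !irr_reprK_pchar // => E.
by rewrite E eqxx in nst.
Qed.

Lemma irr_intertwiner_scalar sigma (f : 'M_(dim sigma)) :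
  (forall g, W sigma g *m f = f *m W sigma g) -> exists c, f = c%:M.
Proof.
move=> fW; apply/is_scalar_mxP; apply: (mx_abs_irr_cent_scalar (rG := W sigma)).
  by apply: (@group_closure_closed_field C gT [set: gT]%G); apply: socle_irr.
by apply/centgmxP=> g _; rewrite fW.
Qed.

Lemma schur_orthogonality_neq sigma tau a b c d : sigma != tau ->
  \sum_g W sigma g a b * W tau g^-1%g c d = 0.
Proof.
by move=> nst; rewrite -rep_avg_delta (irr_intertwiner0 nst (rep_avgJ _ _ _)) mxE.
Qed.

(** The averaged matrix unit is a scalar matrix, and comparing traces gives the scalar. *)
Lemma schur_orthogonality sigma a b c d :
  \sum_g W sigma g a b * W sigma g^-1%g c d
    = (#|gT|%:R / (dim sigma)%:R) * ((a == d) && (b == c))%:R.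
Proof.
have [x xE] := irr_intertwiner_scalar (rep_avgJ (W sigma) (W sigma) (delta_mx b c)).
have d0 : (dim sigma)%:R != 0 :> C by rewrite pnatr_eq0 -lt0n irr_degree_gt0.
have := trace_rep_avg_delta (W sigma) b c.
rewrite -rep_avg_delta xE mxtrace_scalar mxE => xd.
have -> : x = #|gT|%:R / (dim sigma)%:R * (b == c)%:R.
  by apply: (mulIf d0); rewrite [RHS]mulrAC divfK // -xd mulr_natr.
by case: (a == d); rewrite /= ?mulr0.
Qed.

Lemma sum_irr_repr sigma a b :
  \sum_g W sigma g a b = (#|gT| * ((sigma == [1 sG]%irr) && (a == b)))%:R.
Proof.
have [e|ns] /= := eqVneq sigma [1 sG]%irr.
  move: a b; rewrite e => a b.
  rewrite (eq_bigr (fun=> (a == b)%:R)) => [|g _]; last by rewrite irr1_repr ?inE // mxE.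
  by rewrite sumr_const -mulrnA mulnC.
(* For nontrivial [sigma] this is an orthogonality relation with the trivial representation, whose
   single matrix coefficient, at index [o], is 1. *)
have o : 'I_(dim [1 sG]%irr) := Ordinal (irr_degree_gt0 [1 sG]%irr).
rewrite muln0 -[RHS](schur_orthogonality_neq a b o o ns); apply: eq_bigr => g _.
have -> : W [1 sG]%irr g^-1%g o o = 1 by rewrite irr1_repr ?inE // mxE eqxx.
by rewrite mulr1.
Qed.

Lemma chardot_irr1 sigma :
  chardot (rchar (W sigma)) (rchar (W [1 sG]%irr)) = (sigma == [1 sG]%irr)%:R.
Proof.
have cG : #|gT|%:R != 0 :> C by rewrite pnatr_eq0 -lt0n; apply/card_gt0P; exists 1%g.
rewrite /chardot (eq_bigr (fun g => \sum_a W sigma g a a)) => [|g _]; last first.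
  by rewrite /rchar irr1_repr ?inE // mxtrace_scalar degree_irr1 mulr1.
rewrite exchange_big /=; apply: (mulfI cG); rewrite mulVKf //.
have [-> /=|ns] := eqVneq sigma [1 sG]%irr.
  rewrite (eq_bigr (fun=> #|gT|%:R)) => [|a _]; last by rewrite sum_irr_repr !eqxx muln1.
  by rewrite sumr_const card_ord degree_irr1 mulr1.
by rewrite big1 ?mulr0 // => a _; rewrite sum_irr_repr (negPf ns) muln0.
Qed.

End SchurOrthogonality.

(** * Characteristic polynomials of triangular and tensor matrices *)

Section CharPoly.
Variable C : fieldType.

Lemma char_poly_conj n (A B Q : 'M[C]_n) : Q \in unitmx -> A *m Q = Q *m B ->
  char_poly A = char_poly B.
Proof.
move=> Qu e; rewrite /char_poly /char_poly_mx.
have eP : map_mx polyC A *m map_mx polyC Q = map_mx polyC Q *m map_mx polyC B.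
  by rewrite -!map_mxM e.
have : ('X%:M - map_mx polyC A) *m map_mx polyC Q
    = map_mx polyC Q *m ('X%:M - map_mx polyC B).
  by rewrite mulmxBl mulmxBr eP scalar_mxC.
move/(congr1 determinant); rewrite !det_mulmx mulrC => /mulfI; apply.
by rewrite det_map_mx polyC_eq0 -unitfE -unitmxE.
Qed.

(* In a nonzero term of the Leibniz formula ht is nonincreasing along the
   permutation, hence constant, which leaves only the identity. *)
Lemma char_poly_triangular n (T : 'M[C]_n) (ht : 'I_n -> nat) :
  (forall i j, T i j != 0 -> i = j \/ (ht j < ht i)%N) ->
  char_poly T = \prod_i ('X - (T i i)%:P).
Proof.
move=> Ttri; rewrite /char_poly /determinant (bigD1 1%g) //= [X in _ + X]big1 => [|s s1].
  rewrite odd_perm1 expr0 mul1r addr0; apply: eq_bigr => i _.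
  by rewrite !mxE perm1 eqxx.
have [i ni] : exists i, T i (s i) == 0 /\ s i != i.
  have [/forallP h|] := boolP [forall i, (T i (s i) != 0) || (s i == i)]; last first.
    rewrite negb_forall => /existsP[i]; rewrite negb_or negbK => /andP[? ?].
    by exists i.
  have le i : (ht (s i) <= ht i ?= iff (s i == i))%N.
    apply/leqifP; case: eqP => [->//|/eqP ne].
    have := h i; rewrite (negPf ne) orbF => /Ttri[e|//].
    by rewrite -e eqxx in ne.
  have eS : (\sum_i ht (s i) = \sum_i ht i)%N by rewrite [RHS](reindex_inj (@perm_inj _ s)).
  have [_] := leqif_sum (fun i (_ : true) => le i).
  rewrite eS eqxx => /esym/forallP hs.
  by case/eqP: s1; apply/permP=> i; rewrite perm1; apply/eqP; apply: hs.
case: ni => /eqP Ti si; rewrite (bigD1 i) //= !mxE Ti eq_sym (negPf si) mulr0n.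
by rewrite subrr mul0r mulr0.
Qed.

Lemma char_poly_ixmx (I : finType) (E : I -> I -> C) (ht : I -> nat) :
  (forall a b, E a b != 0 -> a = b \/ (ht b < ht a)%N) ->
  char_poly (ixmx E) = \prod_a ('X - (E a a)%:P).
Proof.
move=> Etri; rewrite (@char_poly_triangular _ _ (ht \o enum_val)) => [|i j]; last first.
  by rewrite !mxE => /Etri[/enum_val_inj|]; [left|right].
rewrite (reindex (@enum_val I predT)) /=; last first.
  by exists enum_rank => c _; rewrite (enum_valK, enum_rankK).
by apply: eq_bigr => i _; rewrite mxE.
Qed.

End CharPoly.

(** * Block-diagonal Kronecker products *)

Section BlockOuter.
Variables (C : fieldType) (A S : finType) (n : S -> nat).
Local Notation index := (A * 'I_#|{dffun forall s, 'I_(n s)}|)%type.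
Implicit Types (F G : forall (a : A) (s : S), 'M[C]_(n s)).

(** Block diagonal over [A], each block being the Kronecker product of the [F a s] over [s]. For the
    walk, [A] is the set of cosets and [s] runs over the irreducibles; the second index is an
    ordinal because [outer_mx] is already enumerated. *)
Definition block_outer F : 'M[C]_#|{: index}| :=
  ixmx (fun x y : index => if x.1 == y.1
    then \prod_s F x.1 s (enum_val x.2 s) (enum_val y.2 s) else 0).

Lemma block_outerM F G :
  block_outer F *m block_outer G = block_outer (fun a s => F a s *m G a s).
Proof.
rewrite ixmxM; apply: eq_ixmx => -[a x] [b y] /=.
rewrite -(pair_bigA _ (fun c (z : 'I_#|{dffun forall s, 'I_(n s)}|) =>
  (if a == c then \prod_s F a s (enum_val x s) (enum_val z s) else 0)
  * (if c == b then \prod_s G c s (enum_val z s) (enum_val y s) else 0))) /=.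
rewrite (bigD1 a) //= [X in _ + X]big1 ?addr0 => [|c ca]; last first.
  by apply: big1 => z _; rewrite eq_sym (negPf ca) mul0r.
rewrite eqxx; case: eqP => [_|_]; last by rewrite big1 // => z _; rewrite mulr0.
under [RHS]eq_bigr => s _ do rewrite mxE.
rewrite bigA_distr_dffun (reindex (@enum_rank {dffun forall s, 'I_(n s)})) /=; last first.
  by exists enum_val => c _; rewrite (enum_valK, enum_rankK).
by apply: eq_bigr => c _; rewrite enum_rankK big_split.
Qed.

Lemma block_outer1 : block_outer (fun a s => 1%:M) = 1%:M.
Proof.
rewrite -ixmx1; apply: eq_ixmx => -[a x] [b y] /=.
rewrite -pair_eqE /pair_eq /=; case: eqP => //= _.
under eq_bigr => s _ do rewrite mxE.
have [->|ne] := eqVneq x y; first by rewrite big1 // => s _; rewrite eqxx.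
have [s nes] : exists s, enum_val x s != enum_val y s.
  apply/existsP; apply: contra_neqT ne => /existsPn xy; apply: enum_val_inj.
  by apply/ffunP=> s; apply/eqP; have := xy s; rewrite negbK.
by rewrite (bigD1 s) //= (negPf nes) mul0r.
Qed.

Lemma eq_block_outer F G : (forall a s, F a s = G a s) -> block_outer F = block_outer G.
Proof.
move=> FG; apply: eq_ixmx => -[a x] [b y] /=; case: eqP => // _.
by apply: eq_bigr => s _; rewrite FG.
Qed.

Lemma block_outer_unit F : (forall a s, F a s \in unitmx) -> block_outer F \in unitmx.
Proof.
move=> Fu; suff /mulmx1_unit[] : block_outer F *m block_outer (fun a s =>
  invmx (F a s)) = 1%:M by [].
by rewrite block_outerM -block_outer1; apply: eq_block_outer => a s; rewrite mulmxV.
Qed.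

(** After conjugating factor by factor, the sum of the heights grades the whole matrix: a nonzero
    entry has nonzero entries in all factors, where no height goes up and a height stays equal only
    on the diagonal. *)
Lemma char_poly_block_outer F Q T (ht : forall (a : A) (s : S), 'I_(n s) -> nat) :
  (forall a s, Q a s \in unitmx) -> (forall a s, F a s *m Q a s = Q a s *m T a s) ->
  (forall a s i j, T a s i j != 0 -> i = j \/ (ht a s j < ht a s i)%N) ->
  char_poly (block_outer F)
    = \prod_(x : index) ('X - (\prod_s T x.1 s (enum_val x.2 s) (enum_val x.2 s))%:P).
Proof.
move=> Qu FQ Ttri; rewrite (@char_poly_conj _ _ _ (block_outer T) _ (block_outer_unit
  Qu)); last first.
  by rewrite !block_outerM; apply: eq_block_outer.
rewrite (@char_poly_ixmx _ _ _ (fun x : index => \sum_s ht x.1 s (enum_val x.2 s))%N).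
  by apply: eq_bigr => x _; rewrite eqxx.
move=> [a x] [b y] /=; have [<-|_] := eqVneq a b; last by rewrite eqxx.
move/prodf_neq0=> nz.
have le s : (ht a s (enum_val y s) <= ht a s (enum_val x s) ?= iff (enum_val x s ==
  enum_val y s))%N.
  apply/leqifP; case: eqP => [->//|ne].
  by case: (Ttri _ _ _ _ (nz s isT)).
have [] := leqif_sum (fun s (_ : true) => le s).
rewrite leq_eqVlt => /orP[/eqP->|]; last by right.
rewrite eqxx => /esym/forallP xy; left; congr (_, _); apply: enum_val_inj.
by apply/ffunP=> s; apply/eqP; apply: xy.
Qed.

End BlockOuter.

Section DeltaTensor.
Variables (C : fieldType) (J : finType) (k : nat).
Implicit Types N : 'M[C]_k.

(** The identity on the space with basis [J], tensored with [N]. In the application [J] indexes the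
    basis of a tensor power and [N] acts on the Specht factor. *)
Definition delta_tensor N : 'M[C]_#|{: J * 'I_k}| :=
  ixmx (fun a b : J * 'I_k => (a.1 == b.1)%:R * N a.2 b.2).

Lemma delta_tensorE N x y : delta_tensor N x y
  = ((enum_val x).1 == (enum_val y).1)%:R * N (enum_val x).2 (enum_val y).2.
Proof. by rewrite mxE. Qed.

Lemma delta_tensor_diag N x : delta_tensor N x x = N (enum_val x).2 (enum_val x).2.
Proof. by rewrite delta_tensorE eqxx mul1r. Qed.

Lemma delta_tensorM N N' : delta_tensor N *m delta_tensor N' = delta_tensor (N *m N').
Proof.
rewrite ixmxM; apply: eq_ixmx => -[a i] [b j] /=.
rewrite -(pair_bigA _ (fun c z => (a == c)%:R * N i z * ((c == b)%:R * N' z j))) /=.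
rewrite (bigD1 a) //= [X in _ + X]big1 ?addr0 => [|c ca]; last first.
  by apply: big1 => z _; rewrite eq_sym (negPf ca) !mul0r.
rewrite mxE mulr_sumr; apply: eq_bigr => z _.
by rewrite eqxx mul1r mulrCA.
Qed.

Lemma delta_tensor1 : delta_tensor 1%:M = 1%:M.
Proof.
rewrite -ixmx1; apply: eq_ixmx => -[a i] [b j] /=.
by rewrite mxE -natrM mulnb -pair_eqE.
Qed.

Lemma delta_tensor_unit N : N \in unitmx -> delta_tensor N \in unitmx.
Proof.
move=> Nu; suff /mulmx1_unit[] : delta_tensor N *m delta_tensor (invmx N) = 1%:M by [].
by rewrite delta_tensorM mulmxV // delta_tensor1.
Qed.

End DeltaTensor.

(** * The support of the walk *)

Section WreathElements.
Variables (gT : finGroupType) (m : nat).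
Implicit Types (i p : 'I_m) (g : gT) (t : wreath gT m).

(** These generalise [top_elt] and [swap_elt] to an arbitrary position [p], because moving a coset
    representative across such an element displaces the last position. *)
Definition single_elt p g : wreath gT m :=
  ([ffun k => if k == p then g else 1%g], 1%g).

Definition pair_elt i p g : wreath gT m :=
  ([ffun k => if k == i then g^-1%g else if k == p then g else 1%g], tperm i p).

Lemma wreath_eq t t' : (forall k, t.1 k = t'.1 k) -> (forall k, t.2 k = t'.2 k) -> t = t'.
Proof.
case: t t' => [h s] [h' s'] /= e1 e2; congr (_, _); first exact/ffunP.
exact/permP.
Qed.

Lemma single_eltM t p g :
  (single_elt p g * t = t * single_elt (t.2^-1 p) ((t.1 p)^-1 * g * t.1 p))%g.
Proof.
apply: wreath_eq => k; rewrite !wreath_mulE /= ?permM ?perm1 //.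
rewrite !ffunE invg1 perm1 (inj_eq perm_inj).
by case: eqP => [->|_]; rewrite ?mul1g ?mulg1 // mulgA mulKVg.
Qed.

Lemma pair_eltM t i p g : i != p ->
  (pair_elt i p g * t
   = t * pair_elt (t.2^-1 i) (t.2^-1 p) ((t.1 p)^-1 * g * t.1 i))%g.
Proof.
move=> ip; apply: wreath_eq => k; rewrite !wreath_mulE /= ?permM; last first.
  by rewrite -tpermJ /conjg invgK !permM permKV.
rewrite !ffunE tpermV !(inj_eq perm_inj); case: eqP => [->|/eqP ki].
  by rewrite tpermL !invMg invgK mulKVg.
case: eqP => [->|/eqP kp]; first by rewrite tpermR -!mulgA mulKVg.
by rewrite tpermD ?mul1g ?mulg1 // eq_sym.
Qed.

(** Moving [t] across conjugates [g], which the sum over the group absorbs. *)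
Lemma sum_single_elt (V : nmodType) (f : wreath gT m -> V) t p :
  \sum_g f (single_elt p g * t)%g = \sum_g f (t * single_elt (t.2^-1 p)%g g)%g.
Proof.
rewrite [RHS](reindex_inj (conjg_inj (t.1 p))) /=; apply: eq_bigr => g _.
by rewrite single_eltM conjgE mulgA.
Qed.

(** Here [g] is multiplied on the two sides by different entries of [t], so the sum is reindexed by
    a left and a right translation. *)
Lemma sum_pair_elt (V : nmodType) (f : wreath gT m -> V) t i p : i != p ->
  \sum_g f (pair_elt i p g * t)%g
    = \sum_g f (t * pair_elt (t.2^-1 i)%g (t.2^-1 p)%g g)%g.
Proof.
move=> ip; rewrite [RHS](reindex_inj (mulgI (t.1 p)^-1%g)) /=.
rewrite [RHS](reindex_inj (mulIg (t.1 i))) /=; apply: eq_bigr => g _.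
by rewrite pair_eltM // mulgA.
Qed.

Lemma sum_single_elt_conj (V : nmodType) (f : wreath gT m -> V) s t p :
  \sum_g f (s * single_elt p g * t)%g
    = \sum_g f (s * t * single_elt (t.2^-1 p)%g g)%g.
Proof.
under eq_bigr => g _ do rewrite -mulgA.
rewrite (sum_single_elt (fun y => f (s * y)%g)).
by under eq_bigr => g _ do rewrite mulgA.
Qed.

Lemma sum_pair_elt_conj (V : nmodType) (f : wreath gT m -> V) s t i p : i != p ->
  \sum_g f (s * pair_elt i p g * t)%g
    = \sum_g f (s * t * pair_elt (t.2^-1 i)%g (t.2^-1 p)%g g)%g.
Proof.
move=> ip; under eq_bigr => g _ do rewrite -mulgA.
rewrite (sum_pair_elt (fun y => f (s * y)%g)) //.
by under eq_bigr => g _ do rewrite mulgA.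
Qed.

Lemma sum_pair_elt_conj_all (V : nmodType) (f : wreath gT m -> V) s t p :
  \sum_(i | i != p) \sum_g f (s * pair_elt i p g * t)%g
    = \sum_(i | i != (t.2^-1)%g p) \sum_g f (s * t * pair_elt i (t.2^-1 p)%g g)%g.
Proof.
rewrite [RHS](reindex_inj (@perm_inj _ t.2^-1%g)) /=.
apply: eq_big => [i|i ip]; first by rewrite (inj_eq perm_inj).
exact: sum_pair_elt_conj.
Qed.

(** Isolates the dependence on [g] in a product of elements with trivial permutation. When [i] and
    [p] carry different irreducibles, this product lies in the Young subgroup although the
    transposition does not. *)
Lemma pair_elt_split i p g : i != p ->
  (pair_elt i p g = pair_elt i p 1 * (single_elt i g * single_elt p g^-1))%g.
Proof.
move=> ip; apply: wreath_eq => k; rewrite !wreath_mulE /= ?permM ?perm1 //.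
rewrite !ffunE /= ?invg1 ?perm1 tpermV.
have pi : (p == i) = false by rewrite eq_sym (negPf ip).
case: tpermP => [->|->|/eqP/negPf ki /eqP/negPf kp].
- by rewrite eqxx pi !mul1g eqxx.
- by rewrite pi eqxx (negPf ip) !mul1g mulg1 eqxx.
- by rewrite ki kp !mul1g.
Qed.

End WreathElements.

Lemma sum_walk_prob (C : numFieldType) (gT : finGroupType) n (V : lmodType C)
    (f : wreath gT n.+1 -> V) :
  \sum_x walk_prob C gT n x *: f x = (n.+1%:R * #|gT|%:R)^-1
    *: (\sum_g f (single_elt ord_max g)
        + \sum_(i | i != ord_max) \sum_g f (pair_elt i ord_max g)).
Proof.
pose E1 (g : gT) := single_elt (@ord_max n) g.
pose E2 (y : 'I_n.+1 * gT) := pair_elt y.1 ord_max y.2.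
have E1I : injective E1.
  by move=> g h [/ffunP/(_ ord_max)]; rewrite !ffunE eqxx.
have E2I : {in [pred y | y.1 != ord_max] &, injective E2}.
  move=> [i g] [j h]; rewrite !inE /= => ni nj [/ffunP/(_ ord_max) e /permP/(_ ord_max)].
  rewrite !tpermR => E; rewrite {}E in ni e *; congr (_, _).
  by move: e; rewrite !ffunE eqxx eq_sym (negPf nj).
(* Injectivity and disjointness show that no element of the support is listed twice, so the sum over
   the support splits into sums over [g] and over pairs [(i, g)]. *)
pose S1 := E1 @: setT; pose S2 := E2 @: [set y | y.1 != ord_max].
have S12 : [disjoint S1 & S2].
  rewrite -setI_eq0; apply/eqP/setP=> x; rewrite inE [RHS]inE; apply/andP=> -[].
  case/imsetP=> g _ -> /imsetP[[i h]]; rewrite inE /= => ni [_ /permP/(_ ord_max)].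
  by rewrite perm1 tpermR => e; rewrite -e eqxx in ni.
have wE x : walk_prob C gT n x = if x \in S1 :|: S2 then (n.+1%:R * #|gT|%:R)^-1 else 0.
  rewrite /walk_prob natrM; congr (if _ then _ else _); rewrite inE; congr (_ || _).
    apply/existsP/imsetP => [[g /eqP->]|[g _ ->]]; first by exists g.
    by exists g.
  apply/existsP/imsetP => [[i /andP[ni /existsP[g /eqP->]]]|[[i g]]].
    by exists (i, g) => //; rewrite inE /=; apply: contraTneq ni => ->; rewrite ltnn.
  rewrite inE /= => ni ->; exists i; rewrite ltn_neqAle -ltnS ltn_ord andbT.
  by rewrite ni; apply/existsP; exists g.
under eq_bigr => x _ do rewrite wE.
rewrite (bigID (mem (S1 :|: S2))) /= [X in _ + X]big1 ?addr0 => [|x /negPf->];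
  last by rewrite scale0r.
under eq_bigr => x xS do rewrite xS.
rewrite -scaler_sumr; congr (_ *: _).
rewrite (eq_bigl (fun x => x \in [predU S1 & S2])) => [|x]; last by rewrite !inE.
rewrite bigU //=; congr (_ + _).
  rewrite big_imset /=; last exact: in2W.
  by apply: eq_bigl => g; rewrite inE.
rewrite big_imset /=; last by move=> y z; rewrite !inE => ? ?; apply: E2I; rewrite inE.
by rewrite pair_big /=; apply: eq_bigl => y; rewrite inE andbT.
Qed.

Lemma fourier_walk_ind (C : numFieldType) (gT : finGroupType) n
    (H : {group wreath gT n.+1}) d (r : mx_representation C H d) :
  fourier (walk_prob C gT n) (ind_repr r)
    = ixmx (fun x y => (n.+1%:R * #|gT|%:R)^-1
        * (\sum_g ind_entry r (single_elt ord_max g) x y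
           + \sum_(i | i != ord_max) \sum_g ind_entry r (pair_elt i ord_max g) x y)).
Proof.
rewrite /fourier sum_walk_prob; apply/matrixP=> x y; rewrite !mxE !summxE.
congr (_ * (_ + _)); first by apply: eq_bigr => g _; rewrite mxE.
by apply: eq_bigr => i _; rewrite summxE; apply: eq_bigr => g _; rewrite mxE.
Qed.

(** * Group sums of matrix entries *)

Section InducedSums.
Variables (C : numFieldType) (gT : finGroupType) (n : nat) (H : {group wreath gT n}).
Variables (d : nat) (r : mx_representation C H d).
Local Notation coset_type := {A : {set wreath gT n} | A \in lcosets H [set: wreath gT n]}.
Implicit Types (A B : coset_type) (a b : 'I_d) (y z : wreath gT n) (g : gT).

Lemma lcoset_repr_mem A B : ((repr (val A))^-1 * repr (val B) \in H)%g = (A == B).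
Proof.
have := repr_lcosetV A B 1%g; rewrite mulg1 invg1 mul1g -repr_lcoset => ->.
by rewrite eq_sym.
Qed.

Definition extended_entry a b y : C := if y \in H then r y a b else 0.

Lemma sum_ind_single A a B b p : \sum_g ind_entry r (single_elt p g) (A, a) (B, b)
  = \sum_g extended_entry a b
      ((repr (val A))^-1 * repr (val B) * single_elt ((repr (val B)).2^-1 p) g)%g.
Proof. by rewrite -(sum_single_elt_conj (extended_entry a b)). Qed.

Lemma sum_ind_pair A a B b p :
  \sum_(i | i != p) \sum_g ind_entry r (pair_elt i p g) (A, a) (B, b)
  = \sum_(i | i != (repr (val B)).2^-1%g p) \sum_g extended_entry a b
      ((repr (val A))^-1 * repr (val B) * pair_elt i ((repr (val B)).2^-1 p) g)%g.
Proof. by rewrite -(sum_pair_elt_conj_all (extended_entry a b)). Qed.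

Lemma sum_extended_mem A B a b (y : gT -> wreath gT n) : (forall g, y g \in H) ->
  \sum_g extended_entry a b ((repr (val A))^-1 * repr (val B) * y g)%g
    = if A == B then \sum_g r (y g) a b else 0.
Proof.
move=> yH; under eq_bigr => g _ do rewrite /extended_entry groupMr // lcoset_repr_mem.
have [<-|_] := eqVneq A B; last by rewrite big1.
by rewrite mulVg; under eq_bigr => g _ do rewrite mul1g.
Qed.

(** If [z] lies in [H], its matrix factors out on the left of the vanishing sum; otherwise every
    term is 0. *)
Lemma sum_extended_eq0 a b z (y : gT -> wreath gT n) : (forall g, y g \in H) ->
  (forall c, \sum_g r (y g) c b = 0) -> \sum_g extended_entry a b (z * y g)%g = 0.
Proof.
move=> yH y0; rewrite /extended_entry; under eq_bigr => g _ do rewrite groupMr //.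
have [zH|_] := boolP (z \in H); last by rewrite big1.
under eq_bigr => g _ do rewrite repr_mxM // mxE.
by rewrite exchange_big big1 //= => c _; rewrite -mulr_sumr y0 mulr0.
Qed.

End InducedSums.

Section BlockEntries.
Variables (C : numClosedFieldType) (gT : finGroupType) (sG : irrType C [set: gT]).
Variables (sigma : sG) (lam : seq nat).
Local Notation m := (sumn lam).
Local Notation W := (irr_repr sigma).
Local Notation entry := (@block_entry C gT _ W lam).
Local Notation index := (block_index C (irr_degree sigma) lam).
Implicit Types (a b : index) (k : 'I_m).

Lemma block_entry1 a b : entry 1%g a b = (a == b)%:R.
Proof.
have := repr_mx1 (block_repr W lam) => /matrixP/(_ (enum_rank a) (enum_rank b)).
by rewrite !mxE !enum_rankK (inj_eq enum_rank_inj).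
Qed.

Definition single_rest k a b : C :=
  (\prod_(l | l != k) (a.1 l == b.1 l)%:R) * (a.2 == b.2)%:R.

Lemma block_entry_single k g a b :
  entry (single_elt k g) a b = W g (a.1 k) (b.1 k) * single_rest k a b.
Proof.
rewrite /block_entry /= (@repr_mx1 _ _ _ _ (specht_repr C lam)) invg1 (bigD1 k) //=.
rewrite ffunE eqxx perm1 -mulrA; congr (_ * (_ * _)).
  by apply: eq_bigr => l lk; rewrite ffunE (negPf lk) perm1 repr_mx1 mxE.
by rewrite !mxE eq_sym.
Qed.

Lemma single_restE k a b : (a.1 k == b.1 k)%:R * single_rest k a b = (a == b)%:R.
Proof.
rewrite -block_entry1 -[in RHS](_ : single_elt k 1%g = 1%g :> wreath gT m).
  by rewrite block_entry_single repr_mx1 mxE.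
by apply: wreath_eq => l //=; rewrite !ffunE if_same.
Qed.

Lemma sum_block_entry_single k a b :
  \sum_g entry (single_elt k g) a b
    = #|gT|%:R * (sigma == [1 sG]%irr)%:R * (a == b)%:R.
Proof.
under eq_bigr => g _ do rewrite block_entry_single.
rewrite -mulr_suml sum_irr_repr natrM -mulnb natrM -(single_restE k).
by rewrite !mulrA.
Qed.

Lemma prod_eq_ffun (w w' : {ffun 'I_m -> 'I_(irr_degree sigma)}) :
  \prod_k (w k == w' k)%:R = (w == w')%:R :> C.
Proof.
have [->|ne] := eqVneq w w'; first by rewrite big1 // => k _; rewrite eqxx.
have [k nk] : exists k, w k != w' k.
  by apply/existsP; apply: contra_neqT ne => /existsPn ww; apply/ffunP=> k;
     apply/eqP; have := ww k; rewrite negbK.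
by rewrite (bigD1 k) //= (negPf nk) mul0r.
Qed.

(** The transposition pairs the [k0] index of [a] with the [k1] index of [b], and conversely.
    Orthogonality then compares [a] and [b] at [k0] and at [k1], which undoes the flip and leaves
    the identity on the tensor power. *)
Lemma sum_block_entry_pair k1 k0 a b : k1 != k0 ->
  \sum_g entry (pair_elt k1 k0 g) a b = #|gT|%:R / (irr_degree sigma)%:R
    * ((a.1 == b.1)%:R * specht_repr C lam (tperm k1 k0) b.2 a.2).
Proof.
move=> k10; have k01 : k0 != k1 by rewrite eq_sym.
pose R : C := \prod_(l | (l != k1) && (l != k0)) (a.1 l == b.1 l)%:R.
have eE g : entry (pair_elt k1 k0 g) a b = W g (a.1 k0) (b.1 k1) * W g^-1%g (a.1 k1) (b.1
  k0)
    * (R * specht_repr C lam (tperm k1 k0) b.2 a.2).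
  rewrite /block_entry (bigD1 k1) //= (bigD1 k0) //= !ffunE !eqxx (negPf k01) tpermV.
  rewrite tpermL tpermR [X in _ * (_ * X) * _](_ : _ = R).
    by rewrite [_^T _ _]mxE mulrA [X in X * _ * _]mulrC !mulrA.
  apply: eq_bigr => l /andP[l1 l0]; rewrite ffunE (negPf l1) (negPf l0) repr_mx1.
  by rewrite tpermD ?mxE // eq_sym.
under eq_bigr => g _ do rewrite eE.
rewrite -mulr_suml schur_orthogonality -[LHS]mulrA; congr (_ * _); rewrite mulrA;
  congr (_ * _).
rewrite -prod_eq_ffun (bigD1 k1) // (bigD1 k0) //= -mulnb natrM [b.1 k1 == _]eq_sym.
by rewrite mulrA [X in X * _]mulrC.
Qed.

End BlockEntries.

(** The columns of [B] are independent, so the matrix of a restriction is unique, and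
    [fourier P rho] is one such matrix. *)
Lemma fourier_restriction (C : numFieldType) (aT : finGroupType) (P : aT -> C) d
    (rho : mx_representation C [set: aT] d) (B : 'M[C]_(_, d)) (M : 'M[C]_d) :
  (forall x, is_restriction (regular_repr C [set: aT] x) B (rho x)) ->
  is_restriction (fourier P (regular_repr C [set: aT])) B M -> M = fourier P rho.
Proof.
move=> Brho [rB PB]; have Bfree : row_free B^T by rewrite /row_free mxrank_tr rB.
apply: trmx_inj; apply: (row_free_inj Bfree); rewrite -!trmx_mul -PB; congr _^T.
rewrite /fourier mulmx_suml mulmx_sumr; apply: eq_bigr => x _.
by rewrite -scalemxAl -scalemxAr; case: (Brho x) => _ ->.
Qed.

Lemma char_poly_fourier_rsim (C : fieldType) (aT : finGroupType) (P : aT -> C) d1 d2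
    (r1 : mx_representation C [set: aT] d1) (r2 : mx_representation C [set: aT] d2) :
  mx_rsim r1 r2 -> char_poly (fourier P r1) = char_poly (fourier P r2).
Proof.
case=> B d12; case: d2 / d12 r2 B => r2 B Bfree r12.
apply: (@char_poly_conj _ _ _ _ B); first by rewrite -row_free_unit.
rewrite /fourier mulmx_suml mulmx_sumr; apply: eq_bigr => x _.
by rewrite -scalemxAl -scalemxAr r12 ?inE.
Qed.

Lemma card_diagram lam : is_partition lam ->
  #|[set b : 'I_(sumn lam) * 'I_(sumn lam) | in_diagram lam b.1 b.2]| = sumn lam.
Proof.
move=> lamP; rewrite -sum1dep_card.
rewrite -(pair_big_dep xpredT (fun p q : 'I_(sumn lam) => in_diagram lam p q) (fun _ _ =>
  1%N)) /=.
rewrite (eq_bigr (fun p : 'I_(sumn lam) => nth 0%N lam p)) => [|p _]; last first.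
  by rewrite sum1dep_card card_ord_lt // nth_leq_sumn.
rewrite -(big_mkord xpredT (nth 0%N lam)) (big_cat_nat (leq0n (size lam)) (size_partition
  lamP)) //=.
rewrite [X in (_ + X)%N]big_nat_cond [X in (_ + X)%N]big1 ?addn0 => [|p]; last first.
  by rewrite andbT => /andP[? _]; rewrite nth_default.
by rewrite sumnE [RHS](big_nth 0%N).
Qed.

(** * The Young subgroup inside the wreath product *)

Section YoungEmbedding.
Variables (gT : finGroupType) (I : finType) (m : I -> nat) (n : nat).
Hypothesis mn : (\sum_i m i)%N = n.
Local Notation slot i k := (Tagged (fun l => 'I_(m l)) (k : 'I_(m i))).
Local Notation pos i k := (pos_of mn (Tagged (fun l => 'I_(m l)) (k : 'I_(m i)))).
Local Notation block j := (tag (slot_of mn j)).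
Implicit Types (u : {dffun forall i, wreath gT (m i)}) (y : wreath gT n).

Lemma slot_inj i (k l : 'I_(m i)) : slot i k = slot i l -> k = l.
Proof. by move/eqP; rewrite eq_Tagged => /eqP. Qed.

Lemma pos_inj i (k l : 'I_(m i)) : pos i k = pos i l -> k = l.
Proof. by move/(can_inj (pos_ofK mn))/slot_inj. Qed.

Lemma posP j : j = pos (block j) (tagged (slot_of mn j)).
Proof. by rewrite -[LHS](slot_ofK mn); case: (slot_of mn j). Qed.

Lemma block_pos i (k : 'I_(m i)) : block (pos i k) = i.
Proof. by rewrite pos_ofK. Qed.

Lemma young_emb_fst u i k : (young_emb mn u).1 (pos i k) = (u i).1 k.
Proof. by rewrite ffunE pos_ofK. Qed.

Lemma young_emb_snd u i k : (young_emb mn u).2 (pos i k) = pos i ((u i).2 k).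
Proof. by rewrite permE /young_fun pos_ofK. Qed.

Lemma block_preserving_young y : (forall j, block (y.2 j) = block j) ->
  exists u, young_emb mn u = y.
Proof.
move=> yB.
have sP i : exists s : 'S_(m i), forall k, pos i (s k) = y.2 (pos i k).
  have fP (k : 'I_(m i)) : exists k', pos i k' = y.2 (pos i k).
    have := yB (pos i k); rewrite block_pos; set j := y.2 _ => e.
    have := posP j; move: (tagged _); rewrite e => k' ->; by exists k'.
  have [f fE] := fin_all_exists fP.
  have fI : injective f.
    move=> k l kl; apply: (@pos_inj i); apply: (@perm_inj _ y.2).
    by rewrite -!fE kl.
  by exists (perm fI) => k; rewrite permE.
have [s sE] := fin_all_exists sP.
pose v i : wreath gT (m i) := ([ffun k => y.1 (pos i k)], s i).
exists [ffun i => v i].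
apply: wreath_eq => j; rewrite (posP j); move: (block _) (tagged _) => i k.
  by rewrite young_emb_fst !ffunE.
by rewrite young_emb_snd ffunE /= sE.
Qed.

Lemma young_block_preserving u j : block ((young_emb mn u).2 j) = block j.
Proof.
by rewrite (posP j); move: (block _) (tagged _) => i k; rewrite young_emb_snd !block_pos.
Qed.

(** Reduces membership in the Young subgroup to the permutation part: a permutation preserving the
    blocks restricts to each of them, and the group entries are unconstrained. *)
Lemma young_group_block y :
  reflect (forall j, block (y.2 j) = block j)
          (y \in (invm_morphism (young_injm gT mn) @*^-1 [set: _])%g).
Proof.
rewrite morphpre_invm; apply: (iffP idP) => [/morphimP[u _ _ ->] j|].
  exact: young_block_preserving.
by case/block_preserving_young=> u <-; apply/morphimP; exists u; rewrite ?inE.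
Qed.

Lemma young_single i k g : exists u, [/\ young_emb mn u = single_elt (pos i k) g,
  u i = single_elt k g & forall l, l != i -> u l = 1%g].
Proof.
have [|u uE] := @block_preserving_young (single_elt (pos i k) g).
  by move=> j; rewrite /= perm1.
have u1 l q : (u l).1 q = if pos l q == pos i k then g else 1%g.
  by rewrite -young_emb_fst uE /= ffunE.
have u2 l q : (u l).2 q = q.
  by apply: (@pos_inj l); rewrite -young_emb_snd uE /= perm1.
exists u; split=> // [|l li]; apply: wreath_eq => q; rewrite ?u1 ?u2 /= ?ffunE ?perm1 //.
  by rewrite (inj_eq (@pos_inj i)).
by case: eqP => // /(congr1 (fun j => block j)); rewrite !block_pos => e;
  rewrite e eqxx in li.
Qed.

Lemma young_pair i k1 k0 g : exists u, [/\ young_emb mn u = pair_elt (pos i k1) (pos i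
  k0) g,
  u i = pair_elt k1 k0 g & forall l, l != i -> u l = 1%g].
Proof.
have [|u uE] := @block_preserving_young (pair_elt (pos i k1) (pos i k0) g).
  by move=> j /=; case: tpermP => [->|->|//]; rewrite !block_pos.
have u1 l q : (u l).1 q = if pos l q == pos i k1 then g^-1%g
    else if pos l q == pos i k0 then g else 1%g.
  by rewrite -young_emb_fst uE /= ffunE.
have u2 l q : pos l ((u l).2 q) = tperm (pos i k1) (pos i k0) (pos l q).
  by rewrite -young_emb_snd uE.
have ne l q k : l != i -> (pos l q == pos i k) = false.
  by move=> li; apply: contraNF li => /eqP/(congr1 (fun j => block j));
    rewrite !block_pos => ->.
exists u; split=> // [|l li]; apply: wreath_eq => q.
- by rewrite u1 /= ffunE !(inj_eq (@pos_inj i)).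
- by apply: (@pos_inj i); rewrite u2 /= (inj_tperm _ _ _ (@pos_inj i)).
- by rewrite u1 !ne //= ffunE.
- apply: (@pos_inj l); rewrite u2 /= perm1 tpermD // eq_sym ne //.
Qed.

End YoungEmbedding.

(** * The walk on V^mu *)

Section WalkOperator.
Variables (C : numClosedFieldType) (gT : finGroupType) (sG : irrType C [set: gT]).
Variables (n : nat) (mu : gdiagram sG n.+1).
Local Notation m := (fun sigma : sG => sumn (mu sigma)).
Local Notation mn := (gshape_size mu).
Local Notation pos sigma k := (pos_of mn (Tagged (fun l =>
  'I_(sumn (mu l))) (k : 'I_(sumn (mu sigma))))).
Local Notation block j := (tag (slot_of mn j)).
Local Notation bindex sigma := (block_index C (irr_degree sigma) (mu sigma)).
Local Notation index := 'I_#|{dffun forall sigma : sG, 'I_#|{: bindex sigma}|}|.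
Local Notation comp a sigma := (enum_val (enum_val a sigma)).
Local Notation entry sigma := (@block_entry C gT _ (irr_repr sigma) (mu sigma)).

Definition young_group : {group wreath gT n.+1} :=
  (invm_morphism (young_injm gT mn) @*^-1 [set: _])%G.

Definition young_module : mx_representation C young_group _ := young_repr mu.

Definition young_coset : finType :=
  {A : {set wreath gT n.+1} | A \in lcosets young_group [set: wreath gT n.+1]}.

(** Carries the reference block of each [sigma] onto the positions to which the coset assigns
    [sigma]. This assignment determines the coset. *)
Definition coset_perm (A : young_coset) : 'S_n.+1 :=
  (repr (val (A : {A | A \in lcosets young_group [set: wreath gT n.+1]}))).2.

Local Notation r := young_module.
Implicit Types (A B : young_coset) (a b : index).

Lemma young_groupP (y : wreath gT n.+1) :
  reflect (forall j, block (y.2 j) = block j) (y \in young_group).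
Proof. exact: young_group_block. Qed.

Lemma coset_perm_inj A B :
  (forall j, block ((coset_perm A)^-1%g (coset_perm B j)) = block j) -> A = B.
Proof.
move=> AB; apply/eqP; rewrite -[_ == _](@lcoset_repr_mem _ _ young_group A B).
by apply/young_groupP=> j; rewrite /= permM; apply: AB.
Qed.

Lemma young_reprE u a b :
  r (young_emb mn u) a b = \prod_sigma entry sigma (u sigma) (comp a sigma) (comp b sigma).
Proof.
rewrite /young_module /young_repr /= invmE ?inE // mxE /outer_entry;
  apply: eq_bigr => sigma _.
by rewrite /= mxE.
Qed.

Lemma young_repr_at sigma (x : wreath gT (m sigma))
    (u : {dffun forall l : sG, wreath gT (m l)}) a b : u sigma = x ->
  (forall tau, tau != sigma -> u tau = 1%g) ->
  r (young_emb mn u) a b = entry sigma x (comp a sigma) (comp b sigma)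
    * \prod_(tau | tau != sigma) (enum_val a tau == enum_val b tau)%:R.
Proof.
move=> us u1; rewrite young_reprE (bigD1 sigma) //= us; congr (_ * _).
apply: eq_bigr => tau ts; rewrite u1 // block_entry1.
by rewrite (inj_eq enum_val_inj).
Qed.

Lemma prod_comp_eq a b :
  \prod_sigma (enum_val a sigma == enum_val b sigma)%:R = (a == b)%:R :> C.
Proof.
have [->|ne] := eqVneq a b; first by rewrite big1 // => s _; rewrite eqxx.
have [s nes] : exists s, enum_val a s != enum_val b s.
  apply/existsP; apply: contra_neqT ne => /existsPn xy; apply: enum_val_inj.
  by apply/ffunP=> s; apply/eqP; have := xy s; rewrite negbK.
by rewrite (bigD1 s) //= (negPf nes) mul0r.
Qed.

Lemma sum_pos (V : nmodType) (P : pred 'I_n.+1) (F : 'I_n.+1 -> V) :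
  \sum_(j | P j) F j = \sum_(sigma : sG) \sum_(k | P (pos sigma k)) F (pos sigma k).
Proof.
rewrite (sig_big_dep (J := fun sigma : sG => 'I_(m sigma)) _
  (fun sigma k => P (pos sigma k)) (fun sigma k => F (pos sigma k))) /=.
rewrite (reindex (pos_of mn)) /=; last by exists (slot_of mn) => j _;
  rewrite ?pos_ofK ?slot_ofK.
by apply: eq_big => [[sigma k]|[sigma k] _].
Qed.

Lemma single_mem p g : (single_elt p g : wreath gT n.+1) \in young_group.
Proof. by apply/young_groupP=> j; rewrite /= perm1. Qed.

Lemma pair_mem i p g : block i = block p ->
  (pair_elt i p g : wreath gT n.+1) \in young_group.
Proof.
by move=> ip; apply/young_groupP=> j /=; case: tpermP => [->|->|//]; rewrite ip.
Qed.

Lemma sum_young_single p a b : \sum_g r (single_elt p g) a b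
  = #|gT|%:R * (block p == [1 sG]%irr)%:R * (a == b)%:R.
Proof.
rewrite [p in LHS](posP mn p); move: (block p) (tagged _) => sigma k.
rewrite (eq_bigr (fun g => entry sigma (single_elt k g) (comp a sigma) (comp b sigma)
    * \prod_(tau | tau != sigma) (enum_val a tau == enum_val b tau)%:R)); last first.
  move=> g _; have [u [<- us u1]] := young_single mn k g.
  exact: young_repr_at us u1.
rewrite -mulr_suml sum_block_entry_single -[LHS]mulrA (inj_eq enum_val_inj).
by rewrite -prod_comp_eq [in RHS](bigD1 sigma).
Qed.

Lemma sum_young_single_pair i p a b : block i != block p ->
  \sum_g r (single_elt i g * single_elt p g^-1)%g a b = 0.
Proof.
rewrite (posP mn i) (posP mn p) !block_pos.
move: (block i) (tagged (slot_of mn i)) (block p) (tagged (slot_of mn p)) =>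
  sigma k tau l st.
pose R : C := single_rest k (comp a sigma) (comp b sigma)
  * (single_rest l (comp a tau) (comp b tau)
     * \prod_(rho | (rho != sigma) && (rho != tau)) (enum_val a rho == enum_val b rho)%:R).
rewrite (eq_bigr (fun g => irr_repr sigma g ((comp a sigma).1 k) ((comp b sigma).1 k)
  * irr_repr tau g^-1%g ((comp a tau).1 l) ((comp b tau).1 l) * R)); last first.
  move=> g _; have [u [<- us u1]] := young_single mn k g.
  have [u' [<- us' u1']] := young_single mn l g^-1%g.
  rewrite -young_embM young_reprE (bigD1 sigma) // (bigD1 tau) /=; last by rewrite eq_sym.
  rewrite !ffunE us us' u1' // u1 ?mulg1 ?mul1g; last by rewrite eq_sym.
  rewrite !block_entry_single /R [in LHS](eq_bigr (fun rho =>
    (enum_val a rho == enum_val b rho)%:R)).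
    have aux (x1 x2 x3 x4 x5 : C) : x1 * x2 * (x3 * x4 * x5) = x1 * x3 * (x2 * (x4 * x5)).
      by rewrite -[x3 * x4 * x5]mulrA mulrACA.
    exact: aux.
  move=> rho /andP[rs rt]; rewrite ffunE u1 // u1' // mulg1 block_entry1.
  by rewrite (inj_eq enum_val_inj).
by rewrite -mulr_suml schur_orthogonality_neq // mul0r.
Qed.

(** An arbitrary [z] is allowed because such a pair moves between cosets. The transposition is
    absorbed into [z], and what remains is a sum of products of coefficients of two different
    irreducibles. *)
Lemma sum_extended_pair_diff i p a b z : block i != block p ->
  \sum_g extended_entry r a b (z * pair_elt i p g)%g = 0.
Proof.
move=> ip; have nip : i != p by apply: contraNneq ip => ->.
under eq_bigr => g _ do rewrite (pair_elt_split g nip) mulgA.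
apply: (@sum_extended_eq0 _ _ _ _ _ r a b _
  (fun g => (single_elt i g * single_elt p g^-1)%g)).
  by move=> g; rewrite groupM ?single_mem.
by move=> c; apply: sum_young_single_pair.
Qed.

Lemma sum_young_pair sigma k1 k0 a b : k1 != k0 ->
  \sum_g r (pair_elt (pos sigma k1) (pos sigma k0) g) a b
  = #|gT|%:R / (irr_degree sigma)%:R
    * (((comp a sigma).1 == (comp b sigma).1)%:R
       * specht_repr C (mu sigma) (tperm k1 k0) (comp b sigma).2 (comp a sigma).2)
    * \prod_(tau | tau != sigma) (enum_val a tau == enum_val b tau)%:R.
Proof.
move=> k10; rewrite -sum_block_entry_pair // mulr_suml; apply: eq_bigr => g _.
by have [u [<- us u1]] := young_pair mn k1 k0 g; apply: young_repr_at us u1.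
Qed.

(** The reference position sent to the last one; its block is the irreducible that the coset assigns
    to the last position. *)
Definition last_pos A : 'I_n.+1 := (coset_perm A)^-1%g ord_max.

Lemma sum_ind_walk_single A a B b : \sum_g ind_entry r (single_elt ord_max g) (A, a) (B, b)
  = if A == B then #|gT|%:R * (block (last_pos A) == [1 sG]%irr)%:R * (a == b)%:R else 0.
Proof.
rewrite sum_ind_single sum_extended_mem => [|g]; last exact: single_mem.
have [<-|//] := eqVneq A B; exact: sum_young_single.
Qed.

Lemma sum_ind_walk_pair A a B b sigma k0 : last_pos A = pos sigma k0 ->
  \sum_(i | i != ord_max) \sum_g ind_entry r (pair_elt i ord_max g) (A, a) (B, b)
  = if A == B then \sum_(k1 | k1 != k0) #|gT|%:R / (irr_degree sigma)%:R
    * (((comp a sigma).1 == (comp b sigma).1)%:R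
       * specht_repr C (mu sigma) (tperm k1 k0) (comp b sigma).2 (comp a sigma).2)
    * \prod_(tau | tau != sigma) (enum_val a tau == enum_val b tau)%:R else 0.
Proof.
move=> pA; rewrite sum_ind_pair -/(coset_perm B) -/(last_pos B).
have [AB|AB] := eqVneq A B; last first.
  apply: big1 => i ip; have [e|] := eqVneq (block i) (block (last_pos B)).
    by rewrite sum_extended_mem => [|g]; [rewrite (negPf AB) | apply: pair_mem].
  exact: sum_extended_pair_diff.
rewrite -AB pA sum_pos (bigD1 sigma) //= [X in _ + X]big1 ?addr0 => [|tau ts]; last first.
  by apply: big1 => k _; apply: sum_extended_pair_diff; rewrite !block_pos.
apply: eq_big => [k|k k10]; first by rewrite (inj_eq (@pos_inj _ _ _ mn sigma)).
have {}k10 : k != k0 by apply: contraNneq k10 => ->.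
rewrite sum_extended_mem => [|g]; last by apply: pair_mem; rewrite !block_pos.
by rewrite eqxx -sum_young_pair.
Qed.

(** The outer sum has at most one term. It singles out the slot of the last position without a
    choice, and gives 0 for the blocks that do not contain it. *)
Definition jucys_murphy A sigma : 'M[C]_(\rank (specht_mx C (mu sigma))) :=
  \sum_(k0 | pos sigma k0 == last_pos A) \sum_(k1 | k1 != k0)
    specht_repr C (mu sigma) (tperm k1 k0).

Definition walk_block A sigma : 'M[C]_(\rank (specht_mx C (mu sigma))) :=
  (n.+1%:R * (irr_degree sigma)%:R)^-1
    *: ((sigma == [1 sG]%irr)%:R%:M + (jucys_murphy A sigma)^T).

Definition walk_factor A sigma : 'M[C]_#|{: bindex sigma}| :=
  delta_tensor {ffun 'I_(m sigma) -> 'I_(irr_degree sigma)}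
    (if sigma == block (last_pos A) then walk_block A sigma else 1%:M).

Lemma jucys_murphyE A sigma k0 : last_pos A = pos sigma k0 ->
  jucys_murphy A sigma = \sum_(k1 | k1 != k0) specht_repr C (mu sigma) (tperm k1 k0).
Proof.
move=> e; rewrite /jucys_murphy (big_pred1 k0) // => k.
by rewrite e (inj_eq (@pos_inj _ _ _ mn sigma)).
Qed.

Lemma walk_blockE A sigma s s' : walk_block A sigma s s'
  = (n.+1%:R * (irr_degree sigma)%:R)^-1
    * ((sigma == [1 sG]%irr)%:R * (s == s')%:R + jucys_murphy A sigma s' s).
Proof.
rewrite /walk_block [LHS]mxE; congr (_ * _); rewrite [LHS]mxE; congr (_ + _).
  by rewrite mxE mulr_natr.
by rewrite mxE.
Qed.

Lemma walk_entry A sigma k0 a b : last_pos A = pos sigma k0 ->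
  (n.+1%:R * #|gT|%:R)^-1
    * (#|gT|%:R * (sigma == [1 sG]%irr)%:R * (a == b)%:R
       + \sum_(k1 | k1 != k0) #|gT|%:R / (irr_degree sigma)%:R
           * (((comp a sigma).1 == (comp b sigma).1)%:R
             * specht_repr C (mu sigma) (tperm k1 k0) (comp b sigma).2 (comp a sigma).2)
           * \prod_(tau | tau != sigma) (enum_val a tau == enum_val b tau)%:R)
  = \prod_tau walk_factor A tau (enum_val a tau) (enum_val b tau).
Proof.
move=> pA; have bA : block (last_pos A) = sigma by rewrite pA block_pos.
rewrite -mulr_suml -mulr_sumr -mulr_sumr -prod_comp_eq !(bigD1 sigma (P := xpredT)) //=.
rewrite [X in _ = _ * X](eq_bigr (fun tau => (enum_val a tau == enum_val b tau)%:R));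
  last first.
  move=> tau ts; rewrite /walk_factor bA (negPf ts) delta_tensor1.
  by rewrite mxE.
set R := \prod_(_ | _) _.
rewrite /walk_factor bA eqxx delta_tensorE walk_blockE (jucys_murphyE pA) summxE.
set S := \sum_(_ | _) _.
rewrite -(inj_eq enum_val_inj).
have -> : (comp a sigma == comp b sigma)%:R
    = ((comp a sigma).1 == (comp b sigma).1)%:R * ((comp a sigma).2 == (comp b
      sigma).2)%:R :> C.
  by rewrite -natrM mulnb.
have G0 : #|gT|%:R != 0 :> C by rewrite pnatr_eq0 -lt0n; apply/card_gt0P; exists 1%g.
have d0 : (irr_degree sigma)%:R != 0 :> C by rewrite pnatr_eq0 -lt0n irr_degree_gt0.
have N0 : n.+1%:R != 0 :> C by rewrite pnatr_eq0.
(* The trivial representation has dimension 1, so its indicator may be divided by the dimension;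
   both summands then share the factor of [walk_block]. *)
have tE : (sigma == [1 sG]%irr)%:R = (sigma == [1 sG]%irr)%:R / (irr_degree sigma)%:R :> C.
  by case: eqP => [->|_]; rewrite ?mul0r // degree_irr1 divr1.
rewrite [in LHS]tE; move: (n.+1%:R) N0 => N N0.
by field; rewrite N0 d0.
Qed.

Lemma fourier_walkE :
  fourier (walk_prob C gT n) (V_repr mu) = block_outer walk_factor.
Proof.
rewrite /V_repr fourier_walk_ind; apply: eq_ixmx => -[A a] [B b].
have pA : last_pos A = pos (block (last_pos A)) (tagged (slot_of mn (last_pos A))).
  exact: posP.
have E1 := sum_ind_walk_single A a B b; have E2 := sum_ind_walk_pair a B b pA.
apply: etrans (congr2 (fun s t => (n.+1%:R * #|gT|%:R)^-1 * (s + t)) E1 E2) _.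
case: (A == B); last by rewrite addr0 mulr0.
exact: (walk_entry a b pA).
Qed.

(** * Triangular form and characteristic polynomial of the walk *)

Definition label A sigma (k : 'I_(m sigma)) : nat := coset_perm A (pos sigma k).

Lemma label_inj A sigma : injective (label A (sigma := sigma)).
Proof. by move=> k l /val_inj/perm_inj; apply: pos_inj. Qed.

Lemma label_max A sigma k0 : last_pos A = pos sigma k0 ->
  forall k : 'I_(m sigma), (label A k <= label A k0)%N.
Proof. by move=> e k; rewrite /label -e permKV -ltnS. Qed.

Local Notation stab A sigma i :=
  (std_tab (gshape_partition mu sigma) (@label_inj A sigma) i).

Definition last_content A sigma (i : 'I_(\rank (specht_mx C (mu sigma)))) : int :=
  \sum_(k | pos sigma k == last_pos A) ((stab A sigma i k).2%:Z - (stab A sigma i k).1%:Z).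

Definition last_column A sigma (i : 'I_(\rank (specht_mx C (mu sigma)))) : nat :=
  (\sum_(k | pos sigma k == last_pos A) (stab A sigma i k).2)%N.

Definition walk_diag A sigma i : C :=
  (n.+1%:R * (irr_degree sigma)%:R)^-1
    * ((@last_content A sigma i)%:~R + (sigma == [1 sG]%irr)%:R).

Lemma last_pos_pred1 A sigma k0 : last_pos A = pos sigma k0 ->
  (fun k => pos sigma k == last_pos A) =1 pred1 k0.
Proof. by move=> -> k; rewrite /= (inj_eq (@pos_inj _ _ _ mn sigma)). Qed.

Lemma walk_factor_triangular A sigma :
  exists T : 'M[C]_(\rank (specht_mx C (mu sigma))),
  [/\ walk_factor A sigma *m delta_tensor _ (std_coord C (gshape_partition mu sigma)
    (@label_inj A sigma))^T
        = delta_tensor _ (std_coord C (gshape_partition mu sigma) (@label_inj A sigma))^T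
          *m delta_tensor _ T,
      forall i, T i i = if sigma == block (last_pos A) then walk_diag A i else 1
    & forall i j, T i j != 0 -> i = j \/ (last_column A j < last_column A i)%N].
Proof.
rewrite /walk_factor; have [e|_] := eqVneq; last first.
  exists 1%:M; split=> [|i|i j]; first by rewrite !delta_tensor1 mul1mx mulmx1.
    by rewrite mxE eqxx.
  by rewrite mxE; have [->|] := eqVneq i j; [left|rewrite eqxx].
have [k0 pA] : exists k0, last_pos A = pos sigma k0.
  by rewrite e; exists (tagged (slot_of mn (last_pos A))); apply: posP.
have [T [QT Td Ttri]] := jucys_murphy_triangular C (gshape_partition mu sigma)
  (@label_inj A sigma) (label_max pA).
(* [specht_repr] acts on rows while the block entries use its transpose. Transposing [T] also
   reverses the grading, so the column now decreases. *)
exists ((n.+1%:R * (irr_degree sigma)%:R)^-1 *: ((sigma == [1 sG]%irr)%:R%:M + T^T)).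
split=> [|i|i j].
- rewrite !delta_tensorM /walk_block (jucys_murphyE pA) -scalemxAl -scalemxAr.
  congr (delta_tensor _ (_ *: _)); rewrite mulmxDl mulmxDr scalar_mxC; congr (_ + _).
  by rewrite -trmx_mul QT trmx_mul.
- rewrite mxE [X in _ * X]mxE [X in _ * (X + _)]mxE [X in _ * (_ + X)]mxE Td eqxx addrC.
  by rewrite /walk_diag /last_content (big_pred1 _ (last_pos_pred1 pA)).
- rewrite mxE [X in _ * X]mxE [X in _ * (X + _)]mxE [X in _ * (_ + X)]mxE.
  have [->|ij] := eqVneq i j; first by left.
  rewrite mulr0n add0r mulf_eq0 negb_or => /andP[_ /Ttri[ji|lt]].
    by rewrite ji eqxx in ij.
  by right; rewrite /last_column !(big_pred1 _ (last_pos_pred1 pA)).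
Qed.

Lemma char_poly_walk : char_poly (fourier (walk_prob C gT n) (V_repr mu))
  = \prod_(x : young_coset * index)
      ('X - (walk_diag x.1 (comp x.2 (block (last_pos x.1))).2)%:P).
Proof.
rewrite fourier_walkE.
have [T TP] := fin_all_exists (fun A => fin_all_exists (walk_factor_triangular A)).
rewrite (@char_poly_block_outer _ _ _ _ _
  (fun A sigma => delta_tensor _ (std_coord C (gshape_partition mu sigma) (@label_inj A
    sigma))^T)
  (fun A sigma => delta_tensor _ (T A sigma))
  (fun A sigma i => last_column A (enum_val i).2)); first last.
- move=> A sigma i j; rewrite delta_tensorE;
  have [e|_] := eqVneq (enum_val i).1 (enum_val j).1; last by rewrite mul0r eqxx.
  rewrite mul1r; case: (TP A sigma) => _ _ /[apply] -[e'|]; last by right.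
  left; apply: enum_val_inj; move: e e'.
  by case: (enum_val i) (enum_val j) => [? ?] [? ?] /= -> ->.
- by move=> A sigma; case: (TP A sigma).
- by move=> A sigma; rewrite delta_tensor_unit // unitmx_tr std_coord_unit.
apply: eq_bigr => -[A a] _ /=; congr ('X - _%:P).
(* All factors except that of the last position have diagonal entries 1, so the product reduces to a
   single eigenvalue. *)
rewrite (bigD1 (block (last_pos A))) //= big1 => [|sigma ns].
  by rewrite mulr1 delta_tensor_diag; case: (TP A (block (last_pos A))) => _ -> _;
    rewrite eqxx.
by rewrite delta_tensor_diag; case: (TP A sigma) => _ -> _; rewrite (negPf ns).
Qed.

(** * Standard G-tableaux as a coset with a standard tableau in each block *)

Implicit Types (s : forall sigma : sG, 'I_(\rank (specht_mx C (mu sigma)))).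

Lemma block_size_le sigma : (m sigma <= n.+1)%N.
Proof. by rewrite -[leqRHS](gshape_size mu) (bigD1 sigma) //= leq_addr. Qed.

(** [s] selects a standard tableau for each irreducible. The use of [inord] is faithful because a
    block has at most [n.+1] boxes. *)
Definition gtab A s : {ffun 'I_n.+1 -> gbox sG n.+1} :=
  [ffun j => let w := slot_of mn ((coset_perm A)^-1%g j) in
    (tag w, (inord (stab A (tag w) (s (tag w)) (tagged w)).1,
             inord (stab A (tag w) (s (tag w)) (tagged w)).2))].

Lemma gtab_pos A s sigma k : gtab A s (coset_perm A (pos sigma k))
  = (sigma, (inord (stab A sigma (s sigma) k).1, inord (stab A sigma (s sigma) k).2)).
Proof. by rewrite ffunE permK pos_ofK. Qed.

Lemma inord_block sigma (x : 'I_(m sigma)) : (inord x : 'I_n.+1) = x :> nat.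
Proof. by rewrite inordK // (leq_trans (ltn_ord x)) ?block_size_le. Qed.

Lemma inord_pair_inj sigma (x y x' y' : 'I_(m sigma)) :
  ((inord x, inord y) : 'I_n.+1 * 'I_n.+1) = (inord x', inord y') -> (x, y) = (x', y').
Proof.
case=> /(congr1 val)/= + /(congr1 val)/=; rewrite !inord_block.
by move=> /val_inj-> /val_inj->.
Qed.

Lemma labelP A j : exists sigma k, j = coset_perm A (pos sigma k).
Proof.
exists (block ((coset_perm A)^-1%g j)), (tagged (slot_of mn ((coset_perm A)^-1%g j))).
by rewrite -posP permKV.
Qed.

Lemma gtab_standard A s : standard_gtableau mu (gtab A s).
Proof.
have st sigma : standard (label A (sigma :=
  sigma)) (stab A sigma (s sigma)) by apply: std_tabP.
have tT sigma := standard_tableau (st sigma).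
have gI : injective (gtab A s).
  move=> j j'; have [sigma [k ->]] := labelP A j; have [tau [l ->]] := labelP A j'.
  rewrite !gtab_pos; case=> e; move: k; rewrite {}e {sigma} => k e1 e2.
  have /inord_pair_inj := congr2 pair e1 e2.
  by rewrite -!surjective_pairing => /(tableau_inj (tT tau))->.
apply/and4P; split.
- exact/injectiveP.
- apply/eqP/setP=> b; rewrite inE; apply/imsetP/idP => [[j _ ->]|].
    have [sigma [k ->]] := labelP A j; rewrite gtab_pos /= !inord_block.
    exact: tableau_diagram.
  case: b => sigma [p q] /= pq.
  have [pm qm] := in_diagram_lt (gshape_partition mu sigma) pq.
  have [k tk] := tableau_onto (b := (Ordinal pm, Ordinal qm)) (tT sigma) pq.
  exists (coset_perm A (pos sigma k)) => //; rewrite gtab_pos tk /=.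
  by rewrite !inord_val.
- apply/forallP=> j; apply/forallP=> j'; apply/implyP.
  have [sigma [k ->]] := labelP A j; have [tau [l ->]] := labelP A j'.
  rewrite !gtab_pos /= => /and3P[/eqP e]; move: k; rewrite {}e {sigma} => k.
  rewrite -val_eqE /= !inord_block => /eqP/val_inj e1 e2.
  exact: standard_row (st tau) e1 e2.
- apply/forallP=> j; apply/forallP=> j'; apply/implyP.
  have [sigma [k ->]] := labelP A j; have [tau [l ->]] := labelP A j'.
  rewrite !gtab_pos /= => /and3P[/eqP e]; move: k; rewrite {}e {sigma} => k.
  rewrite -val_eqE /= !inord_block => /eqP/val_inj e1 e2.
  exact: standard_col (st tau) e1 e2.
Qed.

Lemma gtab_inj A B s s' : gtab A s = gtab B s' -> A = B /\ forall sigma, s sigma = s' sigma.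
Proof.
move=> e; have AB : A = B.
  apply: coset_perm_inj => j.
  have := congr1 (fun f : {ffun 'I_n.+1 -> gbox sG n.+1} => (f (coset_perm B j)).1) e.
  by rewrite !ffunE /= permK => <-.
move: s' e; rewrite -{B}AB => s' e; split=> // sigma.
apply: (@std_tab_inj _ _ (gshape_partition mu sigma) _ (@label_inj A sigma)).
apply/ffunP=> k.
have := congr1 (fun f : {ffun 'I_n.+1 -> gbox sG n.+1} => f (coset_perm A (pos sigma k))) e.
rewrite !gtab_pos => -[e1 e2]; have /inord_pair_inj := congr2 pair e1 e2.
by rewrite -!surjective_pairing.
Qed.

(** Each reference block is sent into the list of positions where [f] takes the value [sigma].
    Inequalities suffice, since an injective self-map of ['I_n.+1] is a permutation. *)
Lemma exists_coset (f : 'I_n.+1 -> sG) :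
  (forall sigma, (m sigma <= #|[set j | f j == sigma]|)%N) ->
  exists A, forall sigma k, f (coset_perm A (pos sigma k)) = sigma.
Proof.
move=> le.
pose g sigma (k : 'I_(m sigma)) : 'I_n.+1 := enum_val (widen_ord (le sigma) k).
have fg sigma k : f (@g sigma k) = sigma.
  by have := enum_valP (widen_ord (le sigma) k); rewrite inE => /eqP.
have gI : injective (fun j => g _ (tagged (slot_of mn j))).
  move=> i j; rewrite [X in _ -> X = _](posP mn i) [X in _ -> _ = X](posP mn j).
  move: (block i) (tagged (slot_of mn i)) (block j) (tagged (slot_of mn j)) =>
    sigma k tau l.
  move=> e; have := fg _ k; rewrite e fg => E.
  move: k e; rewrite -{sigma}E => k /enum_val_inj/(congr1 val)/= /val_inj->.
  by [].
pose x : wreath gT n.+1 := ([ffun=> 1%g], perm gI).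
have xA : (x *: young_group)%g \in lcosets young_group [set: wreath gT n.+1].
  by apply/lcosetsP; exists x; rewrite ?inE.
exists (exist (fun A : {set wreath gT n.+1} =>
  A \in lcosets young_group [set: wreath gT n.+1]) _ xA) => sigma k; rewrite /coset_perm /=.
(* The chosen representative is [x] times an element of the Young subgroup, which acts first and
   permutes within the blocks, so the assignment is unchanged. *)
have : repr (x *: young_group)%g \in (x *: young_group)%g.
  by apply: (mem_repr x); apply: lcoset_refl.
case/lcosetP=> y /young_groupP/(_ (pos sigma k)) yH ->.
by rewrite /= permM permE; rewrite block_pos in yH; rewrite fg.
Qed.

Lemma gtab_onto T : standard_gtableau mu T -> exists A s, gtab A s = T.
Proof.
case/and4P=> /injectiveP TI /eqP Tim Trow Tcol.
have Tdiag j : in_diagram (mu (T j).1) (T j).2.1 (T j).2.2.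
  have : T j \in T @: setT by rewrite imset_f ?inE.
  by rewrite Tim inE.
have [|A fA] := exists_coset (f := fun j => (T j).1).
  (* [h] embeds the boxes of [mu sigma] among the values of [T], which shows that enough numbers lie
     in the diagram of [sigma]. *)
  move=> sigma; pose h (b : 'I_(m sigma) * 'I_(m sigma)) : gbox sG n.+1 :=
    (sigma, (inord b.1, inord b.2)).
  have hI : injective h.
    by move=> [x y] [x' y'] [e1 e2]; apply: inord_pair_inj; rewrite e1 e2.
  rewrite -[leqLHS](card_diagram (gshape_partition mu sigma)) -(card_imset _ hI).
  apply: leq_trans (leq_imset_card T _); apply/subset_leq_card/subsetP=> _ /imsetP[b bd ->].
  have : h b \in T @: setT by rewrite Tim !inE /= !inord_block; rewrite inE in bd.
  by case/imsetP=> j _ hj; rewrite hj imset_f // inE -hj.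
(* Read on the block of [sigma] through [coset_perm A], [T] becomes a tableau that is standard for
   [label A], hence one of the [std_tab]. *)
have sP sigma : exists i : 'I_(\rank (specht_mx C (mu sigma))), forall k, let b :=
  (T (coset_perm A (pos sigma k))).2 in
    ((stab A sigma i k).1 = b.1 :> nat) /\ ((stab A sigma i k).2 = b.2 :> nat).
  have dk k : in_diagram (mu sigma) (T (coset_perm A (pos sigma k))).2.1 (T (coset_perm A
    (pos sigma k))).2.2.
    by rewrite -{1}[sigma](fA sigma k); apply: Tdiag.
  have tP (k : 'I_(m sigma)) : exists b : 'I_(m sigma) * 'I_(m sigma),
      (b.1 = (T (coset_perm A (pos sigma k))).2.1 :> nat)
      /\ (b.2 = (T (coset_perm A (pos sigma k))).2.2 :> nat).
    have [pm qm] := in_diagram_lt (gshape_partition mu sigma) (dk k).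
    by exists (Ordinal pm, Ordinal qm).
  have [t0 t0P] := fin_all_exists tP; pose t := finfun t0.
  have t1 k : (t k).1 = (T (coset_perm A (pos sigma k))).2.1 :> nat.
    by rewrite ffunE; case: (t0P k).
  have t2 k : (t k).2 = (T (coset_perm A (pos sigma k))).2.2 :> nat.
    by rewrite ffunE; case: (t0P k).
  have tI : injective t.
    move=> k l e; apply: (@pos_inj _ _ _ mn sigma); apply: (@perm_inj _ (coset_perm A)).
    apply: TI; apply/eqP; rewrite -!pair_eqE /pair_eq /= -pair_eqE /pair_eq /= !fA eqxx /=.
    by rewrite -!val_eqE /= -!t1 -!t2 e !eqxx.
  have st : standard (label A (sigma := sigma)) t.
    apply/and3P; split.
    - rewrite /is_tableau; apply/andP; split; first exact/injectiveP.
      rewrite eqEcard (card_diagram (gshape_partition mu sigma)) card_imset // cardsT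
        card_ord leqnn andbT.
      by apply/subsetP=> _ /imsetP[k _ ->]; rewrite inE t1 t2.
    - apply/forallP=> k; apply/forallP=> l; apply/implyP=> /andP[/eqP e1 lt].
      have /forallP/(_ (coset_perm A (pos sigma k)))/forallP/(_ (coset_perm A (pos sigma
        l)))/implyP := Trow.
      by apply; rewrite !fA eqxx -val_eqE /= -!t1 -!t2 e1 eqxx.
    - apply/forallP=> k; apply/forallP=> l; apply/implyP=> /andP[/eqP e1 lt].
      have /forallP/(_ (coset_perm A (pos sigma k)))/forallP/(_ (coset_perm A (pos sigma
        l)))/implyP := Tcol.
      by apply; rewrite !fA eqxx -val_eqE /= -!t1 -!t2 e1 eqxx.
  have [i it] := std_tab_onto C (gshape_partition mu sigma) (@label_inj A sigma) st.
  by exists i => k /=; rewrite it t1 t2.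
have [s sE] := fin_all_exists sP.
exists A, s; apply/ffunP=> j; have [sigma [k ->]] := labelP A j.
have [e1 e2] := sE sigma k; rewrite gtab_pos e1 e2 !inord_val.
by case: (T _) (fA sigma k) => [tau [p q]] /= ->.
Qed.

(** With the Specht indices fixed, only the tensor indices remain free. The count is done in [C],
    where a sum of products of indicators factors by distributivity. *)
Lemma card_comp_snd s : #|[pred a : index | [forall sigma, (comp a sigma).2 == s sigma]]|
  = (\prod_sigma irr_degree sigma ^ m sigma)%N.
Proof.
apply/eqP; rewrite -(eqr_nat C) -sum1_card natr_sum big_mkcond natr_prod /=.
rewrite (eq_bigr (fun a => \prod_sigma ((comp a sigma).2 == s sigma)%:R)) => [|a _];
  last first.
  rewrite inE; case: ifPn => [/forallP sa|/forallPn[sigma nas]].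
    by rewrite big1 // => sigma _; rewrite sa.
  by rewrite (bigD1 sigma) //= (negPf nas) mul0r.
rewrite (reindex (@enum_rank {dffun forall sigma : sG, 'I_#|{: bindex sigma}|})) /=;
  last first.
  by exists enum_val => c _; rewrite (enum_valK, enum_rankK).
under eq_bigr => f _ do under eq_bigr => sigma _ do rewrite enum_rankK.
rewrite -(bigA_distr_dffun (fun sigma (j : 'I_#|{: bindex sigma}|) =>
  ((enum_val j).2 == s sigma)%:R)).
apply/eqP; apply: eq_bigr => sigma _.
rewrite (reindex (@enum_rank (bindex sigma))) /=; last first.
  by exists enum_val => c _; rewrite (enum_valK, enum_rankK).
under eq_bigr => b _ do rewrite enum_rankK.
rewrite -(pair_bigA _ (fun _ i => (i == s sigma)%:R)) /=.
rewrite (eq_bigr (fun=> 1)) => [|w _]; last first.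
  by rewrite (bigD1 (s sigma)) //= eqxx big1 ?addr0 // => i /negPf->.
by rewrite sumr_const card_ffun !card_ord.
Qed.

Lemma eq_gtab A s s' : (forall sigma, s sigma = s' sigma) -> gtab A s = gtab A s'.
Proof.
move=> e; apply/ffunP=> j; have [sigma [k ->]] := labelP A j.
by rewrite !gtab_pos e.
Qed.

Definition gtab_of (x : young_coset * index) : {ffun 'I_n.+1 -> gbox sG n.+1} :=
  gtab x.1 (fun sigma => (comp x.2 sigma).2).

(** This is the source of the multiplicity: a G-tableau determines the coset and the Specht indices
    of a basis vector, but not its tensor indices. *)
Lemma card_gtab_fiber T : standard_gtableau mu T ->
  #|[pred x | gtab_of x == T]| = (\prod_sigma irr_degree sigma ^ m sigma)%N.
Proof.
move=> /gtab_onto[A [s <-]]; rewrite -(card_comp_snd s) -sum1_card.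
rewrite (eq_bigl (fun x : young_coset * index => (x.1 == A)
    && [forall sigma, (comp x.2 sigma).2 == s sigma])).
  rewrite -(pair_big_dep (fun B => B == A) (fun _ a =>
    [forall sigma, (comp a sigma).2 == s sigma])
    (fun _ _ => 1%N)) /= big_pred1_eq. by rewrite sum1_card.
move=> [B a]; rewrite inE /gtab_of /=;
  apply/eqP/andP => [/gtab_inj[-> e]|[/eqP-> /forallP e]].
  by split=> //; apply/forallP=> sigma; rewrite e.
by apply: eq_gtab => sigma; apply/eqP/e.
Qed.

Lemma gtab_last A s : let sigma := block (last_pos A) in
  (gtab A s ord_max).1 = sigma /\ content (gtab A s ord_max) = last_content A (s sigma).
Proof.
move=> sigma; have pA : last_pos A = pos sigma (tagged (slot_of mn (last_pos A))) by
  apply: posP.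
have <- : coset_perm A (last_pos A) = ord_max by rewrite permKV.
rewrite [in gtab _ _ _]pA gtab_pos; split=> //.
by rewrite /content /= !inord_block /last_content (big_pred1 _ (last_pos_pred1 pA)).
Qed.

Definition walk_eigenvalue (T : {ffun 'I_n.+1 -> gbox sG n.+1}) : C :=
  (n.+1%:R * (irr_degree (T ord_max).1)%:R)^-1
  * ((content (T ord_max))%:~R
     + chardot (rchar (irr_repr (T ord_max).1)) (rchar (irr_repr [1 sG]%irr))).

Lemma walk_eigenvalue_gtab A s :
  walk_eigenvalue (gtab A s) = walk_diag A (s (block (last_pos A))).
Proof.
by rewrite /walk_eigenvalue; case: (gtab_last A s) => -> ->; rewrite chardot_irr1.
Qed.

Lemma char_poly_walk_gtab : char_poly (fourier (walk_prob C gT n) (V_repr mu))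
  = \prod_(T | standard_gtableau mu T)
      ('X - (walk_eigenvalue T)%:P) ^+ (\prod_sigma irr_degree sigma ^ m sigma)%N.
Proof.
apply: etrans char_poly_walk _.
rewrite (partition_big gtab_of (standard_gtableau mu)) /= => [|x _];
  last exact: gtab_standard.
apply: eq_bigr => T Tst; rewrite -(card_gtab_fiber Tst) -prodr_const.
apply: eq_big => // x /eqP <-; congr ('X - _%:P).
by rewrite [RHS]walk_eigenvalue_gtab.
Qed.

End WalkOperator.

Theorem theorem2p6 (C : numClosedFieldType) (gT : finGroupType)
    (gT_nontrivial : (1 < #|gT|)%N) (sG : irrType C [set: gT]) (n : nat)
    (mu : gdiagram sG n.+1) :
  let chi (sigma : sG) := rchar (irr_repr sigma) in
  let eigval (T : {ffun 'I_n.+1 -> gbox sG n.+1}) : C :=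
    let sigma := (T ord_max).1 in
    (n.+1%:R * (irr_degree sigma)%:R)^-1
    * ((content (T ord_max))%:~R + chardot (chi sigma) (chi [1 sG]%irr)) in
  let spectrum : {poly C} :=
    \prod_(T | standard_gtableau mu T)
      ('X - (eigval T)%:P) ^+ (\prod_sigma irr_degree sigma ^ sumn (mu sigma))%N in
  char_poly (fourier (walk_prob C gT n) (V_repr mu)) = spectrum
  /\ forall d (rho : mx_representation C [set: wreath gT n.+1] d)
        (B : 'M[C]_(_, d)) (M : 'M[C]_d),
      mx_rsim rho (V_repr mu) ->
      (forall x, is_restriction (regular_repr C [set: wreath gT n.+1] x) B
                   (rho x)) ->
      is_restriction (fourier (walk_prob C gT n) (regular_repr C [set: wreath gT n.+1]))
        B M ->
      char_poly M = spectrum.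
Proof.
move=> chi eigval spectrum.
have charV := char_poly_walk_gtab mu.
split=> // d rho B M rhoV Brho BM.
by rewrite (fourier_restriction Brho BM) (char_poly_fourier_rsim _ rhoV).
Qed.
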